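(* Let $n\ge 2$, $\alpha\in[1,2)$ and let $\omega$ be a majorant. Suppose that $u\in\mathcal{C}^2(\mathbb{B}^n)$ is a real-valued solution of $\Delta u=\lambda u$ in $\mathbb{B}^n$, where $\lambda$ is a nonnegative constant. Then $u\in\mathcal{L}_{+\infty,\omega}\mathcal{B}^{0}_{\alpha}(\mathbb{B}^n)$, i.e. $$|u(0)|+\sup_{x\in\mathbb{B}^n}\left\{|\nabla u(x)|\,\omega\big(d(x)^{\alpha}\big)\right\}<+\infty,$$ if and only if there is a positive constant $C$ such that, for all $x\in\mathbb{B}^n$ and all $r\in(0,d(x)]$, $$\frac{1}{|\mathbb{B}^n(x,r)|}\int_{\mathbb{B}^n(x,r)}|u(y)-u(x)|\,dy\le\frac{Cr}{\omega(r^{\alpha})}.$$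
   Context: $\mathbb{B}^n(x,r)=\{y\in\mathbb{R}^n:|y-x|<r\}$, $\mathbb{B}^n=\mathbb{B}^n(0,1)$, $|\mathbb{B}^n(x,r)|$ is the volume of $\mathbb{B}^n(x,r)$, and $d(x)=1-|x|$ is the distance from $x\in\mathbb{B}^n$ to $\partial\mathbb{B}^n$. A majorant is a continuous increasing function $\omega:[0,+\infty)\to[0,+\infty)$ with $\omega(0)=0$ such that $\omega(t)/t$ is non-increasing for $t>0$. *)

(* Defs.v *)
From HB Require Import structures.
From mathcomp Require Import all_boot all_order all_algebra.
From mathcomp Require Import all_classical all_reals all_analysis.

Set Implicit Arguments.
Unset Strict Implicit.
Unset Printing Implicit Defensive.

Import Order.TTheory GRing.Theory Num.Theory.
Import numFieldNormedType.Exports.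

Local Open Scope classical_set_scope.
Local Open Scope ring_scope.

(* Lebesgue measure on R^n: the library only has it on R, so it is built here
   as the n-fold product, on the (measurable) type of n-tuples. *)
Section lebesgue_step.
Context {R : realType} {n : nat}.
Let T := measurableTypeR R.

Definition cons_pair (p : T * n.-tuple T) : n.+1.-tuple T :=
  [the n.+1.-tuple T of p.1 :: p.2].

Lemma measurable_cons_pair : measurable_fun [set: T * n.-tuple T] cons_pair.
Proof.
by apply: measurable_cons; [exact: measurable_fst|exact: measurable_snd].
Qed.

Variable mu : {sigma_finite_measure set (n.-tuple T) -> \bar R}.

Definition lebesgue_step : set (n.+1.-tuple T) -> \bar R :=
  pushforward (@lebesgue_measure R \x mu)%E cons_pair.

Let step0 : lebesgue_step set0 = 0%E.
Proof. by rewrite /lebesgue_step /pushforward preimage_set0 measure0. Qed.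

Let step_ge0 A : (0 <= lebesgue_step A)%E.
Proof. by rewrite /lebesgue_step /pushforward; exact: measure_ge0. Qed.

Let step_sigma_additive : semi_sigma_additive lebesgue_step.
Proof.
rewrite /lebesgue_step => F mF tF mUF; rewrite /pushforward preimage_bigcup.
apply: measure_semi_sigma_additive.
- by move=> k; rewrite -[X in measurable X]setTI; exact: measurable_cons_pair.
- apply/trivIsetP => /= i j _ _ ij; rewrite -preimage_setI.
  by move/trivIsetP : tF => /(_ _ _ _ _ ij) ->//; rewrite preimage_set0.
- by rewrite -preimage_bigcup -[X in measurable X]setTI;
     exact: measurable_cons_pair.
Qed.

HB.instance Definition _ := isMeasure.Build _ _ _ lebesgue_step
  step0 step_ge0 step_sigma_additive.

Let step_sigma_finite : sigma_finite setT lebesgue_step.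
Proof.
have /sigma_finiteP[F [TF ndF Foo]] := sigma_finiteT (@lebesgue_measure R).
have /sigma_finiteP[G [TG ndG Goo]] := sigma_finiteT mu.
pose uncons (t : n.+1.-tuple T) : T * n.-tuple T :=
  (tnth t ord0, [tuple of behead t]).
have consK p : uncons (cons_pair p) = p.
  by case: p => x t; congr pair; exact/val_inj.
have muncons : measurable_fun [set: n.+1.-tuple T] uncons.
  apply: measurable_fun_pair; first exact: measurable_tnth.
  exact: measurable_behead.
exists (fun k => uncons @^-1` (F k `*` G k)).
  rewrite -preimage_bigcup; apply/esym/seteqP; split=> // t _.
  have [i _ Fi] : (\bigcup_i F i) (uncons t).1 by rewrite -TF.
  have [j _ Gj] : (\bigcup_i G i) (uncons t).2 by rewrite -TG.
  exists (maxn i j) => //; split.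
    by move: Fi; exact/subsetPset/ndF/leq_maxl.
  by move: Gj; exact/subsetPset/ndG/leq_maxr.
move=> k; have [mF Fk] := Foo k; have [mG Gk] := Goo k; split.
  by rewrite -[X in measurable X]setTI; apply: muncons => //; exact: measurableX.
rewrite /lebesgue_step /pushforward (_ : cons_pair @^-1` _ = F k `*` G k).
  by rewrite product_measure1E// lte_mul_pinfty// ge0_fin_numE.
by rewrite -comp_preimage (_ : uncons \o cons_pair = id)//; exact/funext.
Qed.

HB.instance Definition _ := Measure_isSigmaFinite.Build _ _ _ lebesgue_step
  step_sigma_finite.

End lebesgue_step.

Fixpoint lebesgue_pow {R : realType} (n : nat) :
    {sigma_finite_measure set (n.-tuple (measurableTypeR R)) -> \bar R} :=
  match n with
  | 0 => \d_[tuple]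
  | k.+1 => lebesgue_step (lebesgue_pow k)
  end.

Lemma lebesgue_pow_box (R : realType) (n : nat)
    (A : 'I_n -> set (measurableTypeR R)) : (forall i, measurable (A i)) ->
  lebesgue_pow n [set t | forall i, A i (tnth t i)] =
  (\prod_(i < n) lebesgue_measure (A i))%E.
Proof.
elim: n A => [|n IH] A mA.
  by rewrite big_ord0 /= diracE mem_set// => -[].
rewrite big_ord_recl -IH => [|i]; last exact: mA.
rewrite /= /lebesgue_step /pushforward -product_measure1E//.
- congr product_measure1; apply/seteqP; split=> -[x t] /=.
    move=> H; split=> [|i]; first exact: H ord0.
    by have := H (lift ord0 i); rewrite tnthS.
  by move=> [A0 H] i; case: (unliftP ord0 i) => [j ->|->//]; rewrite tnthS.
- rewrite (_ : [set t | _] = \bigcap_(i in [set: 'I_n])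
      ((@tnth n _)^~ i @^-1` A (lift ord0 i))).
    apply: fin_bigcap_measurable => // i _.
    by rewrite -[X in measurable X]setTI; apply: measurable_tnth.
  by apply/seteqP; split=> t /= H i; [move=> _|]; exact: H.
Qed.

Section euclidean.
Context {R : realType} {n : nat}.
Implicit Types (x y : 'rV[R]_n) (r : R) (f : 'rV[R]_n -> R) (A : set 'rV[R]_n).

(* The library norm on 'rV[R]_n is the sup norm, which induces the same
   topology; balls and gradient lengths below are Euclidean. *)
Definition enorm x : R := Num.sqrt (\sum_(i < n) x 0 i ^+ 2).

Definition eball x r : set 'rV[R]_n := [set y | enorm (y - x) < r].

Definition dist_bd x : R := 1 - enorm x.

Definition partial (i : 'I_n) f : 'rV[R]_n -> R :=
  fun x => 'D_(delta_mx 0 i) f x.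

Definition grad f x : 'rV[R]_n := \row_i partial i f x.

Definition laplacian f x : R := \sum_(i < n) partial i (partial i f) x.

(* These are meant for open A, where the derivatives and the continuity at
   points of A only depend on the restriction of f to A. *)
Definition C1_on A f : Prop :=
  (forall x, A x -> {for x, continuous f}) /\
  forall i x, A x ->
    derivable f x (delta_mx 0 i) /\ {for x, continuous (partial i f)}.

Definition C2_on A f : Prop := C1_on A f /\ forall i, C1_on A (partial i f).

Definition row_of_tuple (t : n.-tuple (measurableTypeR R)) : 'rV[R]_n :=
  \row_i tnth t i.

Definition volume A : \bar R := lebesgue_pow n (row_of_tuple @^-1` A).

Definition ball_mean x r f : \bar R :=
  ((volume (eball x r))^-1 *
   \int[lebesgue_pow n]_(t in row_of_tuple @^-1` eball x r)
     (f (row_of_tuple t))%:E)%E.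

(* The weighted Bloch norm, with values in [0, +oo]. *)
Definition bloch_norm (omega : R -> R) (alpha : R) f : \bar R :=
  (`|f 0|%:E + ereal_sup
     [set (enorm (grad f x) * omega (dist_bd x `^ alpha))%:E
       | x in eball 0 1%R])%E.

End euclidean.

(* Only the values of omega on [0, +oo[ matter.  "Increasing" is taken in the
   wide sense; positivity on ]0, +oo[, automatic for a strictly increasing
   omega, then excludes exactly omega = 0 on [0, +oo[. *)
Definition majorant {R : realType} (omega : R -> R) : Prop :=
  [/\ {within `[0, +oo[, continuous omega},
      omega 0 = 0,
      {in `[0, +oo[ &, {homo omega : s t / s <= t}},
      forall t, 0 < t -> 0 < omega t
    & forall s t, 0 < s -> s <= t -> omega t / t <= omega s / s].

(* Main.v *)
(** Along a radius from [x], the Bloch condition bounds the increment of [u]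
    between the distances [(1 - 2^-j) r] and [(1 - 2^-(j+1)) r] by a constant times
    [2^((alpha-1)(j+1)) r / omega (r^alpha)], while the outer shell where this increment
    occurs has relative volume at most [n 2^-j]; since [alpha < 2] the resulting series
    converges.

    Conversely, put [z = y - x], [w = s^2 - |z|^2] and [P_k(s) = \int w_+^k z_e u].
    Green's formula applied to [w_+^3 z_e] says that [Q(s) = s^-(n+6) P_2(s)] satisfies
    [Q' = lambda s^-(n+7) P_3 / 6].  As [w_+^k z_e] has zero integral, [u] may be replaced
    in [P_k] by [u - u x], so that the mean oscillation bounds both [Q] and [Q'];
    [Q(s)] tends to a positive multiple of the partial derivative of [u] at [x] as [s -> 0],
    and [Q'] is small enough to be summed over dyadic scales. *)
Require Import Defs.
From mathcomp Require Import all_boot all_order all_algebra.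
From mathcomp Require Import all_classical all_reals all_analysis.
From mathcomp Require Import measurable_realfun ring lra.
Import Order.TTheory GRing.Theory Num.Theory.
Import numFieldNormedType.Exports.
Local Open Scope classical_set_scope.
Local Open Scope ring_scope.

(** * Lebesgue measure on R^n *)

(** Both halves meet the same obstacle: [1 / omega (s^alpha)] may blow up as [s -> 0], and a
    majorant only guarantees [omega ((c s)^alpha) >= c^alpha omega (s^alpha)] for [0 < c <= 1].
    Halving the scale can thus cost a factor [2^alpha], and two factors [1/2] have to be gained
    against it. In the first half they come from the length and from the volume of a shell; in the
    second, from the size of [Q'] and from the length of a dyadic interval. The ratio is
    [2^(alpha-2)] both times.

    The weights [w_+^k] replace the sharp cutoff of a ball. As [w_+^3 z_e] is of class C^2 on the
    whole space, every integral runs over R^n and no surface integral appears. The exponent [n + 6]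
    is the homogeneity of [P_2] on the linear part of [u] at [x]: [n] from the volume, 2 from
    [z_e^2], 4 from [w^2]. So [Q] is a weighted mean value of the partial derivative, constant in
    [s] when [u] is harmonic. *)

Section affine_measure.
Context {R : realType}.
Implicit Types (a s : R).

Definition affine1 a s (t : measurableTypeR R) : measurableTypeR R := a + s * t.

Lemma measurable_affine1 a s : measurable_fun setT (affine1 a s).
Proof.
apply: measurable_funD; first exact: measurable_cst.
by apply: measurable_funM => //; exact: measurable_id.
Qed.

(** The left side is a measure in [A]; on half-open intervals the identity is a computation, and
    these intervals determine Lebesgue measure. *)
Lemma lebesgue_measure_affine a s (s0 : 0 < s) (A : set (measurableTypeR R)) :
  measurable A ->
  (s%:E * lebesgue_measure (affine1 a s @^-1` A) = lebesgue_measure A)%E.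
Proof.
move=> mA.
pose m_ : measure _ R := mscale (NngNum (ltW s0))
  (pushforward lebesgue_measure (affine1 a s)).
pose m := m_ (measurable_affine1 a s).
suff : m A = lebesgue_measure A by [].
apply/esym/lebesgue_measure_unique => //= _ [[c d]] _ <-.
rewrite /m/m_/= /mscale /= /pushforward.
rewrite (_ : _ @^-1` _ = `](c - a) / s, (d - a) / s]%classic); last first.
  apply/seteqP; split => t /=; rewrite !in_itv/= /affine1 => /andP[h1 h2]; apply/andP; split.
  - by rewrite ltr_pdivrMr//; lra.
  - by rewrite ler_pdivlMr//; lra.
  - by move: h1; rewrite ltr_pdivrMr//; lra.
  - by move: h2; rewrite ler_pdivlMr//; lra.
rewrite !lebesgue_measure_itv/= !lte_fin ltr_pM2r ?invr_gt0// ltrD2r.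
case: ifPn => [cd|_]; last by rewrite mule0.
by rewrite -!EFinD -EFinM; congr EFin; field; lra.
Qed.

End affine_measure.

Section affine_pow.
Context {R : realType}.
Implicit Types (s : R).
Local Notation T := (measurableTypeR R).

Definition affine_tuple {n} (a : n.-tuple R) s (t : n.-tuple T) : n.-tuple T :=
  [tuple affine1 (tnth a i) s (tnth t i) | i < n].

Lemma measurable_affine_tuple {n} (a : n.-tuple R) s :
  measurable_fun setT (affine_tuple a s).
Proof.
apply/measurable_fun_tnthP => i.
rewrite (_ : _ \o _ = affine1 (tnth a i) s \o (@tnth n T ^~ i)); last first.
  by apply/funext => t /=; rewrite tnth_mktuple.
apply: measurableT_comp; first exact: measurable_affine1.
exact: measurable_tnth.
Qed.

Definition box {n} (A : 'I_n -> set T) : set (n.-tuple T) :=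
  [set t | forall i, A i (tnth t i)].

Lemma measurable_box {n} (A : 'I_n -> set T) :
  (forall i, measurable (A i)) -> measurable (box A).
Proof.
move=> mA; rewrite (_ : box A = \bigcap_(i in [set: 'I_n])
    ((@tnth n _)^~ i @^-1` A i)).
  apply: fin_bigcap_measurable => // i _.
  by rewrite -[X in measurable X]setTI; apply: measurable_tnth.
by apply/seteqP; split=> t /= H i; [move=> _|]; exact: H.
Qed.

Definition boxes n : set (set (n.-tuple T)) :=
  [set box A | A in [set A | forall i, measurable (A i)]].

(** Puts the sigma-algebra of tuples, generated by the coordinate maps, in the form that
    [measure_unique] asks for. *)
Lemma measurable_boxes n :
  (measurable : set (set (n.-tuple T))) = <<s @boxes n >>.
Proof.
apply/seteqP; split => [A|]; last first.
  apply: smallest_sub; first exact: sigma_algebra_measurable.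
  by move=> _ [A mA <-]; exact: measurable_box.
rewrite /measurable/=; apply: smallest_sub; first exact: smallest_sigma_algebra.
move=> X; rewrite -bigcup_seq => -[i /= _] [B mB <-].
(* A cylinder over one coordinate is a box whose other sides are full lines. *)
apply: sub_sigma_algebra; exists (fun j => if j == i then B else setT).
  by move=> j; case: ifP.
rewrite setTI; apply/seteqP; split => t /= => [/(_ i)|Bt j]; first by rewrite eqxx.
by case: eqP => [->|].
Qed.

Lemma boxesI n : setI_closed (@boxes n).
Proof.
move=> _ _ [A mA <-] [B mB <-]; exists (fun i => A i `&` B i).
  by move=> i; apply: measurableI.
by apply/seteqP; split=> [t At|t [At Bt] i]; [split=> i; case: (At i)|split].
Qed.

Lemma lebesgue_pow_itv n (a b : 'I_n -> R) : (forall i, a i <= b i) ->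
  lebesgue_pow n (box (fun i => `]a i, b i[%classic)) =
  (\prod_(i < n) (b i - a i))%:E.
Proof.
move=> ab; rewrite lebesgue_pow_box; last by move=> i; exact: measurable_itv.
rewrite -prodEFin; apply: eq_bigr => i _.
rewrite lebesgue_measure_itv/= lte_fin; case: ltgtP (ab i) => //= ->.
by rewrite subrr.
Qed.

(** Measures that agree on boxes are equal, as boxes are stable under intersection and cubes of
    finite measure exhaust the space. Scale 1 gives translation invariance, a general scale the
    volume of balls. *)
Lemma lebesgue_pow_affine n (a : n.-tuple R) s (s0 : 0 < s)
    (A : set (n.-tuple T)) : measurable A ->
  ((s ^+ n)%:E * lebesgue_pow n (affine_tuple a s @^-1` A) =
   lebesgue_pow n A)%E.
Proof.
move=> mA.
have sn0 : 0 <= s ^+ n by rewrite exprn_ge0// ltW.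
pose m_ : measure _ R := mscale (NngNum sn0)
  (pushforward (lebesgue_pow n) (affine_tuple a s)).
pose m := m_ (measurable_affine_tuple a s).
suff : m A = lebesgue_pow n A by [].
pose I k : 'I_n -> set T := fun=> `]- k%:R, k%:R[%classic.
have mI k i : measurable (I k i) by exact: measurable_itv.
have mbox B : boxes n B -> m B = lebesgue_pow n B.
  move=> [{}B mB <-]; rewrite /m/m_/= /mscale/= /pushforward.
  rewrite (_ : _ @^-1` _ = box (fun i => affine1 (tnth a i) s @^-1` B i)); last first.
    by apply/seteqP; split => t /= Bt i; move: (Bt i); rewrite tnth_mktuple.
  rewrite !lebesgue_pow_box//; last first.
    by move=> i; rewrite -[X in measurable X]setTI; apply: measurable_affine1.
  rewrite (_ : (s ^+ n)%:E = \prod_(i < n) s%:E)%E; last first.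
    by rewrite prodEFin prodr_const card_ord.
  by rewrite -big_split/=; apply: eq_bigr => i _; rewrite lebesgue_measure_affine.
apply: (measure_unique (boxes n) (fun k => box (I k))) => //.
- exact: measurable_boxes.
- exact: boxesI.
- by move=> k; exists (I k).
- rewrite -subTset => t _.
  exists (Num.bound (\sum_(i < n) `|tnth t i|)) => // i.
  rewrite /I/= in_itv/= -ltr_norml.
  apply: (@le_lt_trans _ _ (\sum_(i < n) `|tnth t i|)).
    by rewrite (bigD1 i)//= lerDl sumr_ge0.
  by apply: archi_boundP; rewrite sumr_ge0.
- move=> k; rewrite mbox; last by exists (I k).
  by rewrite lebesgue_pow_itv ?ltry// => i; rewrite -subr_ge0 opprK addr_ge0.
Qed.

End affine_pow.

Lemma continuous_sum (R : realType) (T : topologicalType) (I : Type) (r : seq I)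
    (f : I -> T -> R) (x : T) : (forall i, {for x, continuous (f i)}) ->
  {for x, continuous (fun y => \sum_(i <- r) f i y)}.
Proof.
move=> cf; elim: r => [|i r IH].
  rewrite (_ : (fun _ => _) = cst 0); last by apply/funext => y; rewrite big_nil.
  exact: cst_continuous.
rewrite (_ : (fun _ => _) = f i + (fun y => \sum_(i <- r) f i y)); last first.
  by apply/funext => y; rewrite big_cons.
by apply: continuousD.
Qed.

(** * Measurability of open sets and of continuous functions on row vectors *)

Section row_measurable.
Context {R : realType} {n : nat}.
Implicit Types (x : 'rV[R]_n) (U : set 'rV[R]_n).

Lemma row_of_tupleE (t : n.-tuple (measurableTypeR R)) i :
  row_of_tuple t 0 i = tnth t i.
Proof. by rewrite mxE. Qed.

(** Rows carry the topology of the sup norm, so an open set is the countable union of the open cubes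
    with rational centre and half-side [1/(k+1)] that it contains. [F] enumerates these cubes, with
    [set0] at the indices that code none. *)
Lemma measurable_row_open U : open U -> measurable (@row_of_tuple R n @^-1` U).
Proof.
move=> oU.
pose d k : R := k.+1%:R^-1.
have d0 k : 0 < d k by rewrite invr_gt0.
pose B (p : n.-tuple rat * nat) : set (n.-tuple (measurableTypeR R)) :=
  box (fun i => `](ratr (tnth p.1 i) - d p.2), (ratr (tnth p.1 i) + d p.2)[%classic).
pose F m := if @unpickle (n.-tuple rat * nat)%type m is Some p then
  if `[< B p `<=` row_of_tuple @^-1` U >] then B p else set0 else set0.
rewrite (_ : _ @^-1` _ = \bigcup_m F m); last first.
  apply/seteqP; split=> [t Ut|t [m _]]; last first.
    by rewrite /F; case: unpickle => // p; case: asboolP => // + Bt; apply.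
  have /nbhs_ballP[e /= e0 eU] : nbhs (row_of_tuple t) U by exact: open_nbhs_nbhs.
  (* Half of [e], because the rational centre is within [d k] of [t] and the points of the cube are
     within [d k] of the centre. *)
  have e20 : 0 < e / 2 by rewrite divr_gt0.
  have [k _ /(_ k (leqnn _)) kd] := near_infty_natSinv_lt (PosNum e20).
  have /choice[q qP] : forall i, exists q : rat,
      ratr q \in `](tnth t i - d k), (tnth t i + d k)[.
    move=> i; have : tnth t i - d k < tnth t i + d k :> R.
      by rewrite ltrBlDr -addrA ltrDl addr_gt0.
    by case/rat_in_itvoo => q; exists q.
  pose p := ([tuple q i | i < n], k).
  have BtU : B p `<=` row_of_tuple @^-1` U.
    move=> s Bs; apply: eU; split=> // j i; rewrite !mxE.
    have := Bs i; have := qP i; rewrite /= !in_itv/= tnth_mktuple.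
    move=> /andP[h1 h2] /andP[h3 h4].
    rewrite /ball/= ltr_norml; move: kd; rewrite /= -/(d k) => kd.
    by apply/andP; split; lra.
  exists (pickle p) => //; rewrite /F pickleK; case: asboolP => // _ i.
  by have := qP i; rewrite /= !in_itv/= tnth_mktuple => /andP[h1 h2]; apply/andP; split; lra.
apply: bigcupT_measurable => m; rewrite /F; case: unpickle => // p.
by case: ifP => // _; apply: measurable_box => i; exact: measurable_itv.
Qed.

(** Continuity is asked at the points of [U] only, since [u] is unconstrained outside the unit
    ball. *)
Lemma measurable_row_cont U (f : 'rV[R]_n -> R) : open U ->
  (forall x, U x -> {for x, continuous f}) ->
  measurable_fun (@row_of_tuple R n @^-1` U) (f \o row_of_tuple).
Proof.
move=> oU cf; apply: (measurability _ (RGenOpens.measurableE R)).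
move=> _ [_ [a [b ->] <-]].
rewrite (_ : _ `&` _ = row_of_tuple @^-1` (U `&` f @^-1` `]a, b[))//.
apply: measurable_row_open.
rewrite openE => x [Ux fx]; rewrite /interior.
apply: filterI; first exact: open_nbhs_nbhs.
by apply: cf => //; apply: open_nbhs_nbhs; split => //; exact: interval_open.
Qed.

End row_measurable.

(** * Euclidean norm and Euclidean balls *)

Section enorm.
Context {R : realType} {n : nat}.
Implicit Types (x y : 'rV[R]_n) (r : R).

Lemma enorm_ge0 x : 0 <= enorm x.
Proof. exact: sqrtr_ge0. Qed.

Lemma enorm_sqr x : enorm x ^+ 2 = \sum_(i < n) x 0 i ^+ 2.
Proof. by rewrite sqr_sqrtr// sumr_ge0// => i _; rewrite sqr_ge0. Qed.

Lemma coord_le_enorm x i : `|x 0 i| <= enorm x.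
Proof.
rewrite -(@ler_pXn2r _ 2)// ?nnegrE ?enorm_ge0// enorm_sqr real_normK ?num_real//.
by rewrite (bigD1 i)//= lerDl sumr_ge0// => j _; rewrite sqr_ge0.
Qed.

(** Cauchy-Schwarz: with [A], [B] the squared norms and [C] the scalar product, [B (A B - C^2)] is
    the sum of the squares of [B x_i - C y_i]. *)
Lemma dot_le_enorm x y : `|\sum_(i < n) x 0 i * y 0 i| <= enorm x * enorm y.
Proof.
set C := \sum_(i < n) _.
rewrite -(@ler_pXn2r _ 2)// ?nnegrE ?mulr_ge0 ?enorm_ge0//.
rewrite real_normK ?num_real// exprMn !enorm_sqr.
set A := \sum_(i < n) _ ^+ 2; set B := \sum_(i < n) _ ^+ 2.
have A0 : 0 <= A by apply: sumr_ge0 => i _; exact: sqr_ge0.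
have B0 : 0 <= B by apply: sumr_ge0 => i _; exact: sqr_ge0.
have [Bz|Bn] := eqVneq B 0.
  suff -> : C = 0 by rewrite expr0n/= mulr_ge0.
  apply: big1 => i _.
  suff : y 0 i ^+ 2 = 0 by move/eqP; rewrite sqrf_eq0 => /eqP ->; rewrite mulr0.
  by apply: (psumr_eq0P _ Bz) => // j _; exact: sqr_ge0.
have : 0 <= \sum_(i < n) (B * x 0 i - C * y 0 i) ^+ 2.
  by apply: sumr_ge0 => i _; exact: sqr_ge0.
have -> : \sum_(i < n) (B * x 0 i - C * y 0 i) ^+ 2 = B * (A * B - C ^+ 2).
  transitivity (\sum_(i < n) (B ^+ 2 * x 0 i ^+ 2 -
    (2 * B * C) * (x 0 i * y 0 i) + C ^+ 2 * y 0 i ^+ 2)).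
    by apply: eq_bigr => i _; ring.
  by rewrite big_split/= sumrB -!mulr_sumr -/A -/B -/C; ring.
by rewrite pmulr_rge0 ?lt_neqAle 1?eq_sym ?Bn// subr_ge0.
Qed.

Lemma enormD x y : enorm (x + y) <= enorm x + enorm y.
Proof.
rewrite -(@ler_pXn2r _ 2)// ?nnegrE ?addr_ge0 ?enorm_ge0//.
rewrite enorm_sqr sqrrD !enorm_sqr.
rewrite (_ : \sum_(i < n) _ = \sum_(i < n) x 0 i ^+ 2 +
    (\sum_(i < n) x 0 i * y 0 i) *+ 2 + \sum_(i < n) y 0 i ^+ 2); last first.
  rewrite -sumrMnl -!big_split/=; apply: eq_bigr => i _.
  by rewrite mxE sqrrD.
rewrite lerD2r lerD2l lerMn2r/=; apply: le_trans (dot_le_enorm x y).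
exact: ler_norm.
Qed.

Lemma enormZ r x : enorm (r *: x) = `|r| * enorm x.
Proof.
rewrite /enorm; under eq_bigr do rewrite mxE exprMn.
by rewrite -mulr_sumr sqrtrM ?sqr_ge0// sqrtr_sqr.
Qed.

Lemma enorm0 : enorm (0 : 'rV[R]_n) = 0.
Proof. by rewrite -(scale0r 0) enormZ normr0 mul0r. Qed.

Lemma enormN x : enorm (- x) = enorm x.
Proof. by rewrite -scaleN1r enormZ normrN1 mul1r. Qed.

Lemma enorm_eq0 x : enorm x = 0 -> x = 0.
Proof.
move=> x0; apply/rowP => i; rewrite mxE; apply/eqP; rewrite -normr_le0 -x0.
exact: coord_le_enorm.
Qed.

Lemma enorm_le_sum x : enorm x <= \sum_(i < n) `|x 0 i|.
Proof.
rewrite -(@ler_pXn2r _ 2)// ?nnegrE ?enorm_ge0 ?sumr_ge0// enorm_sqr.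
rewrite [leRHS]expr2 mulr_suml; apply: ler_sum => i _.
rewrite -real_normK ?num_real// expr2.
by apply: ler_wpM2l => //; rewrite (bigD1 i)//= lerDl sumr_ge0.
Qed.

Lemma continuous_coordB x0 i : continuous (fun y : 'rV[R]_n => y 0 i - x0 0 i).
Proof.
by move=> y; apply: continuousB; [exact: coord_continuous|exact: cst_continuous].
Qed.

Lemma continuous_enorm_sqr x0 :
  continuous (fun y : 'rV[R]_n => \sum_(i < n) (y 0 i - x0 0 i) ^+ 2).
Proof.
move=> y; apply: continuous_sum => i.
apply: (@continuous_comp _ _ _ (fun y : 'rV[R]_n => y 0 i - x0 0 i) (fun r => r ^+ 2)).
  exact: continuous_coordB.
exact: exprn_continuous.
Qed.

Lemma continuous_enormB x0 : continuous (fun y => enorm (y - x0)).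
Proof.
move=> y; rewrite (_ : (fun _ => _) = Num.sqrt \o
    (fun y : 'rV[R]_n => \sum_(i < n) (y 0 i - x0 0 i) ^+ 2)); last first.
  by apply/funext => z; rewrite /enorm/=; congr Num.sqrt; apply: eq_bigr => i _; rewrite !mxE.
by apply: continuous_comp; [exact: continuous_enorm_sqr|exact: sqrt_continuous].
Qed.

Lemma open_eball x r : open (eball x r).
Proof.
rewrite (_ : eball x r = (fun y => enorm (y - x)) @^-1` [set t | t < r]) //.
apply: open_comp => [y _|]; [exact: continuous_enormB|exact: open_lt].
Qed.

Lemma closed_eball x r : closed [set y | enorm (y - x) <= r].
Proof.
apply: (@closed_comp _ _ (fun y => enorm (y - x)) [set t | t <= r]) => [y _|].
  exact: continuous_enormB.
exact: closed_le.
Qed.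

Lemma eball_subset x r r' : r <= r' -> eball x r `<=` eball x r'.
Proof. by move=> rr y /= /lt_le_trans; apply. Qed.

Lemma measurable_eball x r : measurable (@row_of_tuple R n @^-1` eball x r).
Proof. by apply: measurable_row_open; exact: open_eball. Qed.

End enorm.

(** * Volume of Euclidean balls *)

Section volume.
Context {R : realType} {n : nat}.
Implicit Types (x : 'rV[R]_n) (r : R).

Lemma row_affine_tuple (a : n.-tuple (measurableTypeR R)) s t :
  row_of_tuple (affine_tuple a s t) = row_of_tuple a + s *: row_of_tuple t.
Proof. by apply/rowP => i; rewrite !mxE tnth_mktuple. Qed.

Definition tuple_of_row x : n.-tuple R := [tuple x 0 i | i < n].

Lemma tuple_of_rowK x : row_of_tuple (tuple_of_row x) = x.
Proof. by apply/rowP => i; rewrite mxE tnth_mktuple. Qed.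

(** The proof never computes this number; [volume_bounds] shows that it is finite and positive. *)
Definition uvol : R := fine (volume (eball (0 : 'rV[R]_n) 1)).

(** The ball lies between two cubes: half-side [1/(n+1)] keeps the sum of the absolute coordinates
    at most [n/(n+1) < 1], and each coordinate of a point of the ball is below 1 in absolute
    value. *)
Lemma volume_bounds :
  (((2 / n.+1%:R) ^+ n)%:E <= volume (eball (0 : 'rV[R]_n) 1) <= (2 ^+ n)%:E)%E.
Proof.
have mB (a b : R) : measurable (box (fun _ : 'I_n => `]a, b[%classic)).
  by apply: measurable_box => i; exact: measurable_itv.
have VB (c : R) : 0 <= c -> lebesgue_pow n (box (fun _ : 'I_n => `](- c), c[%classic)) =
    ((2 * c) ^+ n)%:E.
  move=> c0; rewrite lebesgue_pow_itv => [|i]; last by lra.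
  by rewrite prodr_const card_ord; congr ((_ ^+ _)%:E); lra.
apply/andP; split.
- rewrite -VB ?invr_ge0//; apply: le_measure; rewrite ?inE//.
  + exact: measurable_eball.
  + move=> t Bt; rewrite /eball/= subr0; apply: le_lt_trans (enorm_le_sum _) _.
    apply: (@le_lt_trans _ _ (\sum_(i < n) n.+1%:R^-1)).
      apply: ler_sum => i _; rewrite mxE; have := Bt i; rewrite /= in_itv/=.
      by rewrite -ltr_norml => /ltW.
    rewrite sumr_const card_ord -[ltLHS]mulr_natl ltr_pdivrMr// mul1r.
    by rewrite ltr_nat.
- rewrite -[2]mulr1 -VB//; apply: le_measure; rewrite ?inE//.
    exact: measurable_eball.
  move=> t Bt i; rewrite /= in_itv/= -ltr_norml -row_of_tupleE.
  by apply: le_lt_trans (coord_le_enorm _ _) _; move: Bt; rewrite /eball/= subr0.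
Qed.

Lemma volume1E : volume (eball (0 : 'rV[R]_n) 1) = uvol%:E.
Proof.
have /andP[h1 h2] := volume_bounds.
rewrite /uvol fineK// ge0_fin_numE ?(le_lt_trans h2) ?ltry//.
Qed.

Lemma uvol_ge : (2 / n.+1%:R) ^+ n <= uvol.
Proof. by rewrite -lee_fin -volume1E; case/andP: volume_bounds. Qed.

Lemma uvol_gt0 : 0 < uvol.
Proof. by apply: lt_le_trans uvol_ge; rewrite exprn_gt0. Qed.

Lemma volumeE x r : 0 < r -> volume (eball x r) = (r ^+ n * uvol)%:E.
Proof.
move=> r0; rewrite /volume -(@lebesgue_pow_affine _ _ (tuple_of_row x) r)//; last first.
  exact: measurable_eball.
rewrite EFinM -volume1E; congr (_ * lebesgue_pow n _)%E.
apply/seteqP; split => t /=; rewrite /eball/= subr0 row_affine_tuple tuple_of_rowK;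
  by rewrite (addrC (x : 'rV_n)) addrK enormZ gtr0_norm// gtr_pMr.
Qed.

End volume.

(** * Functions with continuous partial derivatives *)

Section directional.
Context {R : realType} {V : normedModType R}.
Implicit Types (f g : V -> R) (p v : V).

(** The two difference quotients are the same function of [h]. This carries one-variable calculus
    over to directional derivatives. *)
Lemma is_derive_line f p v (t d : R) :
  is_derive (p + t *: v) v f d <-> is_derive t 1 (fun s : R => f (p + s *: v)) d.
Proof.
have E : (fun h : R => h^-1 *: (f (h *: v + (p + t *: v)) - f (p + t *: v))) =
    (fun h : R => h^-1 *: ((fun s : R => f (p + s *: v)) (h *: (1 : R) + t) - f (p + t *: v))).
  by apply/funext => h /=; rewrite [h%:A]mulr1 scalerDl addrCA.
by split => -[D1 D2]; apply: DeriveDef; move: D1 D2; rewrite /derivable /derive;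
  [rewrite E|rewrite E|rewrite -E|rewrite -E].
Qed.

(** As [f] is only derivable along [v], the chain rule is applied on the line through [p], where
    derivability in one variable implies differentiability. *)
Lemma is_derive_comp1 f (h : R -> R) p v (df dh : R) :
  is_derive p v f df -> is_derive (f p) 1 h dh ->
  is_derive p v (h \o f) (dh * df).
Proof.
move=> Hf Hh; rewrite -[p]addr0 -(scale0r v); apply/is_derive_line.
have /is_derive_line Hf0 : is_derive (p + (0 : R) *: v) v f df by rewrite scale0r addr0.
set g := fun s : R => f (p + s *: v).
have g0 : g 0 = f p by rewrite /g scale0r addr0.
rewrite -[fun _ => _]/(h \o g).
case: Hf0 => dg Dg; case: Hh; rewrite -g0 => dh' Dh; apply: DeriveDef.
  have dG := (@derivable1_diffP _ _ g 0).1 dg; have dH := (@derivable1_diffP _ _ h (g 0)).1 dh'.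
  exact: (@derivable1_diffP _ _ (h \o g) 0).2 (differentiable_comp dG dH).
have := @derive1_comp _ g h 0 dg dh'.
by rewrite (derive1E (h \o g)) (derive1E h) (derive1E g) Dh Dg.
Qed.

End directional.

Section mvt.
Context {R : realType}.
Implicit Types (h dh : R -> R).

Lemma norm_le_of_between (a t : R) :
  Num.min 0 a <= t <= Num.max 0 a -> `|t| <= `|a|.
Proof.
have := ler_norm a; have := ler_norm (- a); rewrite normrN => n1 n2.
by rewrite ge_min le_max ler_norml => /andP[/orP[]? /orP[]?];
  apply/andP; split; lra.
Qed.

(** Mean value inequality relative to a slope [c]: [c = 0] bounds an increment, [c] a partial
    derivative bounds a linearization error. The endpoints are unordered because a coordinate may be
    negative and because the scales [sj j] decrease. *)
Lemma mvt_approx h dh (a b K c : R) :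
  (forall t, Num.min a b <= t <= Num.max a b -> is_derive t 1 h (dh t) /\ `|dh t - c| <= K) ->
  `|h b - h a - c * (b - a)| <= K * `|b - a|.
Proof.
wlog ab : a b / a <= b => [H|].
  have [ab|ba] := orP (le_total a b); first exact: H.
  move=> Hd; rewrite (distrC b a).
  rewrite (_ : h b - h a - c * (b - a) = - (h a - h b - c * (a - b))); last by ring.
  rewrite normrN.
  by apply: H => // t; rewrite minC maxC; exact: Hd.
rewrite min_l// max_r// => Hd.
have [t||t tab ->] := @MVT_segment R h dh a b ab.
- by rewrite in_itv/= => /andP[/ltW ta /ltW tb]; apply: (Hd t _).1; rewrite ta.
- apply: derivable_within_continuous => t; rewrite in_itv/= => tab.
  by have [[]] := Hd t tab.
- rewrite -mulrBl normrM; apply: ler_wpM2r => //.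
  by apply: (Hd t _).2; rewrite in_itv/= in tab.
Qed.

End mvt.

Section C1.
Context {R : realType} {n : nat}.
Implicit Types (f : 'rV[R]_n -> R) (x z v : 'rV[R]_n) (A : set 'rV[R]_n).

(** The displacement reached when [x] is moved to [x + z] one coordinate at a time and [k]
    coordinates are done. *)
Let trunc z (k : nat) : 'rV[R]_n := \row_i (if (i < k)%N then z 0 i else 0).

Let truncS z (k : 'I_n) : trunc z k.+1 = trunc z k + z 0 k *: delta_mx 0 k.
Proof.
apply/rowP => i; rewrite !mxE eqxx/= ltnS leq_eqVlt.
have [->|ik] := eqVneq i k; first by rewrite eqxx ltnn add0r mulr1.
by rewrite (negbTE ik : (i == k :> nat) = false)/= mulr0 addr0.
Qed.

Lemma norm_rv_lt z (e : R) : 0 < e -> (forall i, `|z 0 i| < e) -> `|z| < e.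
Proof.
move=> e0 H; rewrite [ltLHS]/Num.norm/= mx_normrE.
by apply/bigmax_ltP; split => // -[i j] _ /=; rewrite (ord1 i).
Qed.

(** Continuous partial derivatives give Frechet differentiability: each of the [n] moves along an
    axis has error at most [e' * enorm z], and [e' = e / (n+1)] keeps the total below [e * enorm z],
    also for [n = 0]. *)
Lemma C1_linear_approx A f x (e : R) : open A -> C1_on A f -> A x -> 0 < e ->
  \forall z \near (0 : 'rV[R]_n),
    `|f (x + z) - f x - \sum_(i < n) partial i f x * z 0 i| <= e * enorm z.
Proof.
move=> oA [_ C1] Ax e0.
pose e' := e / n.+1%:R; have e'0 : 0 < e' by rewrite divr_gt0.
have N : \forall y \near x, A y /\ forall i, `|partial i f y - partial i f x| <= e'.
  have N1 i : \forall y \near x, `|partial i f y - partial i f x| <= e'.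
    have [_ /cvgrPdist_le/(_ _ e'0)] := C1 i _ Ax.
    by apply: filterS => y; rewrite distrC.
  near=> y; split; first by near: y; exact: open_nbhs_nbhs.
  by near: y; apply: filter_forall.
have /nbhs_ballP[d /= d0 dN] := N.
near=> z.
have zd i : `|z 0 i| < d.
  apply: le_lt_trans (coord_le_enorm z i) _; near: z.
  have := @continuous_enormB R n 0 0; rewrite /continuous_at subrr enorm0.
  move/cvgrPdist_lt => /(_ _ d0); apply: filterS => z.
  by rewrite subr0 sub0r normrN ger0_norm// enorm_ge0.
have step (k : 'I_n) : `|f (x + trunc z k.+1) - f (x + trunc z k) -
    partial k f x * z 0 k| <= e' * enorm z.
  have := @mvt_approx R (fun s => f (x + trunc z k + s *: delta_mx 0 k))
    (fun s => partial k f (x + trunc z k + s *: delta_mx 0 k)) 0 (z 0 k) e'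
    (partial k f x).
  rewrite /= scale0r !addr0 subr0 -(addrA x) -truncS => H.
  apply: le_trans (H _) _; last by apply: ler_wpM2l; rewrite ?(ltW e'0)// coord_le_enorm.
  move=> t tz; have /dN[Ay Hy] : ball x d (x + trunc z k + t *: delta_mx 0 k).
    rewrite -ball_normE/= -addrA opprD addrA subrr add0r normrN.
    apply: norm_rv_lt => // i; rewrite !mxE eqxx/=.
    have [->|ik] := eqVneq i k.
      rewrite ltnn add0r mulr1; apply: le_lt_trans (zd k).
      exact: norm_le_of_between tz.
    by rewrite mulr0 addr0; case: ifP => // _; rewrite normr0.
  split; last exact: Hy.
  apply: (is_derive_line f (x + trunc z k) (delta_mx 0 k) t _).1.
  have [D _] := C1 k _ Ay; exact: derivableP D.
have tele m (mn : (m <= n)%N) : `|f (x + trunc z m) - f x -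
    \sum_(i < n | (i < m)%N) partial i f x * z 0 i| <= (e' * enorm z) *+ m.
  elim: m mn => [_|m IH mn].
    rewrite (_ : trunc z 0 = 0); last by apply/rowP => i; rewrite !mxE.
    by rewrite addr0 subrr big_pred0// subr0 normr0 mulr0n.
  rewrite (bigD1 (Ordinal mn))//=.
  rewrite (eq_bigl (fun i : 'I_n => (i < m)%N)); last first.
    by move=> i; rewrite -val_eqE/= ltnS ltn_neqAle andbC.
  rewrite mulrS.
  apply: le_trans (lerD (step (Ordinal mn)) (IH (ltnW mn))).
  apply: le_trans (ler_normD _ _); rewrite le_eqVlt; apply/orP; left; apply/eqP.
  by congr `|_|; rewrite /=; ring.
have := tele n (leqnn _).
have -> : \sum_(i < n | (i < n)%N) partial i f x * z 0 i =
    \sum_(i < n) partial i f x * z 0 i by apply: eq_bigl => i; rewrite ltn_ord.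
rewrite (_ : trunc z n = z); last by apply/rowP => i; rewrite mxE ltn_ord.
move/le_trans; apply; rewrite -mulr_natr /e'.
rewrite [leLHS](_ : _ = e * enorm z * (n%:R / n.+1%:R)); last by ring.
rewrite ler_piMr// ?mulr_ge0 ?enorm_ge0 ?(ltW e0)//.
by rewrite ler_pdivrMr// mul1r ler_nat.
Unshelve. all: by end_near. Qed.

Lemma C1_is_derive A f x v : open A -> C1_on A f -> A x ->
  is_derive x v f (\sum_(i < n) partial i f x * v 0 i).
Proof.
move=> oA C1 Ax.
suff H : h^-1 *: (f (h *: v + x) - f x) @[h --> 0^'] -->
    (\sum_(i < n) partial i f x * v 0 i : R).
  by apply: DeriveDef; [apply/cvg_ex; eexists; exact: H|exact: cvg_lim].
apply/cvgrPdist_le => e e0.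
(* Dividing by [enorm v + 1] instead of [enorm v] covers [v = 0]. *)
have v0 : 0 < enorm v + 1 by rewrite ltr_wpDl ?enorm_ge0.
have e'0 : 0 < e / (enorm v + 1) by rewrite divr_gt0.
have N := near0Z v (C1_linear_approx A f x _ oA C1 Ax e'0).
have NZ : \forall h \near (0 : R)^', h != 0 by exact: nbhs_dnbhs_neq.
have N' : \forall h \near (0 : R)^', `|f (x + h *: v) - f x -
    \sum_(i < n) partial i f x * (h *: v) 0 i| <= e / (enorm v + 1) * enorm (h *: v).
  exact/cvg_within/N.
move: NZ N'; apply: filterS2 => h h0.
under eq_bigr do rewrite mxE mulrCA.
rewrite -mulr_sumr enormZ (addrC (h *: v)) => H.
rewrite -(ler_pM2l (_ : 0 < `|h|)) ?normr_gt0// -normrM.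
rewrite (_ : h * _ = - (f (x + h *: v) - f x - h * \sum_(i < n) partial i f x * v 0 i)).
  rewrite normrN; apply: le_trans H _; rewrite mulrCA ler_wpM2l// mulrAC ler_pdivrMr//.
  by rewrite ler_wpM2l ?(ltW e0)// lerDl.
by rewrite [_ *: _]/(_ * _) mulrBr mulrA mulfV// mul1r; ring.
Qed.

Lemma C1_mvt A f p v (a b K : R) : open A -> C1_on A f -> a <= b ->
  (forall t, a <= t <= b -> A (p + t *: v) /\ enorm (grad f (p + t *: v)) <= K) ->
  `|f (p + b *: v) - f (p + a *: v)| <= K * enorm v * (b - a).
Proof.
move=> oA C1 ab H.
have := @mvt_approx R (fun s => f (p + s *: v))
  (fun s => \sum_(i < n) partial i f (p + s *: v) * v 0 i) a b (K * enorm v) 0.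
rewrite mul0r subr0 min_l// max_r// (ger0_norm (_ : 0 <= b - a)) ?subr_ge0//.
move=> mvt; apply: mvt => t /H[At Kt]; split.
  by apply: (is_derive_line f p v t _).1; exact: C1_is_derive oA C1 At.
rewrite subr0; apply: le_trans (_ : enorm (grad f (p + t *: v)) * enorm v <= _).
  apply: le_trans (dot_le_enorm _ _); rewrite le_eqVlt; apply/orP; left; apply/eqP.
  by congr `|_|; apply: eq_bigr => i _; rewrite mxE.
by rewrite ler_wpM2r ?enorm_ge0.
Qed.

End C1.

(** * From the Bloch condition to the mean oscillation *)

Section scalar_facts.
Context {R : realType}.
Implicit Types (omega : R -> R) (alpha c k r t z : R).

(** The monotonicity of [omega t / t] enters the proof only through this bound on the decay of
    [omega] at 0. *)
Lemma majorant_le_scale omega k t : majorant omega -> 0 < k <= 1 -> 0 < t ->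
  k * omega t <= omega (k * t).
Proof.
move=> [_ _ _ _ H] /andP[k0 k1] t0.
have kt0 : 0 < k * t by rewrite mulr_gt0.
have /H : 0 < k * t := kt0.
have kt : k * t <= t by rewrite ger_pMl.
move=> /(_ t kt); rewrite ler_pdivrMr//.
rewrite (_ : omega (k * t) / (k * t) * t = omega (k * t) / k); last by field; lra.
by rewrite ler_pdivlMr// mulrC.
Qed.

Lemma majorant_powR_scale omega alpha c r : majorant omega -> 0 <= alpha ->
  0 < c <= 1 -> 0 < r -> c `^ alpha * omega (r `^ alpha) <= omega ((c * r) `^ alpha).
Proof.
move=> mo a0 /andP[c0 c1] r0; rewrite powRM ?(ltW c0) ?(ltW r0)//.
apply: majorant_le_scale => //; rewrite ?powR_gt0//=.
by rewrite -(powRr0 c) ger_powR// c0.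
Qed.

Lemma powR_exprn c alpha (j : nat) : 0 <= c -> (c ^+ j) `^ alpha = (c `^ alpha) ^+ j.
Proof.
move=> c0; rewrite -!powR_mulrn ?powR_ge0//.
by rewrite -!powRrM mulrC.
Qed.

Lemma majorant_homo omega alpha s t : majorant omega -> 0 <= alpha -> 0 <= s <= t ->
  omega (s `^ alpha) <= omega (t `^ alpha).
Proof.
move=> [_ _ H _ _] a0 /andP[s0 st].
apply: H; rewrite ?in_itv/= ?powR_ge0// ge0_ler_powR// nnegrE//.
exact: le_trans st.
Qed.

Lemma geometric_sum_le z (N : nat) : 0 <= z < 1 -> \sum_(0 <= j < N) z ^+ j <= (1 - z)^-1.
Proof.
move=> /andP[z0 z1]; have z10 : 0 < 1 - z by rewrite subr_gt0.
rewrite -[leRHS]mul1r ler_pdivlMr//.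
suff -> : (\sum_(0 <= j < N) z ^+ j) * (1 - z) = 1 - z ^+ N by rewrite gerBl exprn_ge0.
elim: N => [|N IH]; first by rewrite big_nil mul0r expr0 subrr.
by rewrite big_nat_recr//= mulrDl IH exprS; ring.
Qed.

Lemma bernoulli_le c (n : nat) : 0 <= c <= 1 -> 1 - (1 - c) ^+ n <= n%:R * c.
Proof.
move=> /andP[c0 c1]; elim: n => [|n IH]; first by rewrite expr0 subrr mul0r.
have /andP[p0 p1] : 0 <= (1 - c) ^+ n <= 1.
  by rewrite exprn_ge0 ?exprn_ile1//; lra.
rewrite exprS -natr1; nra.
Qed.

(* The ratio is [2^(alpha - 2)]. *)
Lemma half_powR_ratio alpha : alpha < 2 -> 0 <= (2^-1 : R) / 2^-1 `^ alpha * 2^-1 < 1.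
Proof.
move=> a2; set h : R := 2^-1; have h0 : 0 < h by rewrite /h; lra.
rewrite mulr_ge0 ?divr_ge0 ?powR_ge0 ?(ltW h0)//= mulrAC ltr_pdivrMr ?powR_gt0// mul1r.
have h1 : h <= 1 by rewrite /h; lra.
rewrite -expr2 -powR_mulrn ?(ltW h0)// lt_neqAle ger_powR ?h0 ?h1 ?(ltW a2)//.
rewrite andbT; apply/eqP.
(* Strictness: after taking logarithms, equality would force [alpha = 2] or [ln h = 0]. *)
move=> E; have : ln (h `^ 2%:R) = ln (h `^ alpha) by rewrite E.
rewrite !ln_powR => /eqP; rewrite -subr_eq0 -mulrBl mulf_eq0 => /orP[/eqP|].
  by move: a2; lra.
by rewrite ln_eq0// => /eqP; rewrite /h; lra.
Qed.

End scalar_facts.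

Section shells.
Context {R : realType} {n : nat}.
Implicit Types (x : 'rV[R]_n) (r c : R).

(** The shell is the fraction [1 - (1-c)^n] of the ball, at most [n c] by Bernoulli's inequality. *)
Lemma volume_shell x r c : (0 < n)%N -> 0 < r -> 0 <= c <= 1 ->
  (volume (eball x r `\` eball x ((1 - c) * r)) <=
   (n%:R * c * (r ^+ n * @uvol R n))%:E)%E.
Proof.
move=> n0 r0 /andP[c0 c1].
have m1 := @measurable_eball R n x r; have m2 := @measurable_eball R n x ((1 - c) * r).
have V0 : 0 <= r ^+ n * @uvol R n by rewrite mulr_ge0 ?(ltW (@uvol_gt0 R n))// exprn_ge0 ?ltW.
(* For [c = 1] the inner radius is 0, where [volumeE] does not apply. *)
have [c1'|c1'] := eqVneq c 1.
  apply: le_trans (_ : volume (eball x r) <= _)%E.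
    apply: le_measure; rewrite ?inE//; last by move=> t [].
    by rewrite /= -[X in measurable X]/(_ `\` _); exact: measurableD.
  by rewrite volumeE// lee_fin c1' mulr1 ler_peMl// ler1n.
have c1r : 0 < (1 - c) * r by rewrite mulr_gt0// subr_gt0 lt_neqAle c1'.
have sub : eball x ((1 - c) * r) `<=` eball x r by apply: eball_subset; nra.
have fin : (volume (eball x r) < +oo)%E by rewrite volumeE// ltry.
have -> : (volume (eball x r `\` eball x ((1 - c) * r)) =
    volume (eball x r) - volume (eball x ((1 - c) * r)))%E.
  rewrite -[in X in (_ - X)%E](setIidr sub).
  exact: (@measureD _ _ _ (lebesgue_pow n) _ _ m1 m2 fin).
rewrite !volumeE//.
rewrite -EFinB lee_fin exprMn.
rewrite (_ : _ - _ = (1 - (1 - c) ^+ n) * (r ^+ n * @uvol R n)); last by ring.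
by rewrite ler_wpM2r// bernoulli_le// c0.
Qed.

End shells.

Section bloch_to_oscillation.
Context {R : realType} {n : nat}.
Variables (omega : R -> R) (alpha M : R) (u : 'rV[R]_n -> R).
Hypothesis n0 : (0 < n)%N.
Hypothesis alpha12 : 1 <= alpha < 2.
Hypothesis maj : majorant omega.
Hypothesis M0 : 0 <= M.
Hypothesis C1u : C1_on (eball 0 1) u.
Hypothesis bloch : forall x, eball 0 1 x ->
  enorm (grad u x) * omega (dist_bd x `^ alpha) <= M.

Let h : R := 2^-1.
(** [p = 2^(alpha-1)] is the growth per shell of the bound on the increment of [u]; the volume
    brings the further factor [h] that makes [p * h < 1]. *)
Let p : R := h / h `^ alpha.

Let a1 : 1 <= alpha. Proof. by case/andP: alpha12. Qed.

Let a2 : alpha < 2. Proof. by case/andP: alpha12. Qed.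

Let alpha0 : 0 <= alpha. Proof. exact: le_trans a1. Qed.

Let h01 : 0 < h <= 1. Proof. by rewrite /h; lra. Qed.

Let h0 : 0 < h. Proof. by case/andP: h01. Qed.

Let hj01 j : 0 < h ^+ j <= 1.
Proof.
have /andP[_ h1] := h01; rewrite exprn_gt0 ?h0//=.
exact: exprn_ile1 (ltW h0) h1.
Qed.

Let p0 : 0 <= p. Proof. by rewrite divr_ge0 ?powR_ge0// ltW. Qed.

Let ph1 : 0 <= p * h < 1.
Proof. exact: half_powR_ratio. Qed.

Section one_ball.
Variables (x : 'rV[R]_n) (r : R).
Hypothesis rd : 0 < r <= dist_bd x.

Let r0 : 0 < r. Proof. by case/andP: rd. Qed.

Let om0 : 0 < omega (r `^ alpha).
Proof. by case: maj => _ _ _ + _; apply; rewrite powR_gt0. Qed.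

Let K : R := M * r / omega (r `^ alpha).

Let K0 : 0 <= K.
Proof. by rewrite divr_ge0 ?(ltW om0)// mulr_ge0// ltW. Qed.

Let Kp0 j : 0 <= K * p ^+ j.
Proof. by apply: mulr_ge0 => //; exact: exprn_ge0. Qed.

Let rho j : R := (1 - h ^+ j) * r.

Let rho_ge0 j : 0 <= rho j.
Proof. by have /andP[_ ?] := hj01 j; rewrite mulr_ge0 ?subr_ge0// ltW. Qed.

(** Up to distance [rho j.+1] from [x] the boundary is still at least [2^-(j+1) r] away, because
    [r <= dist_bd x]. So the gradient is at most [M 2^(alpha (j+1)) / omega (r^alpha)], along a
    length of at most [2^-(j+1) r]. *)
Let rho_step j (v : 'rV[R]_n) (s t : R) : enorm v = 1 -> rho j <= s -> s <= t ->
  t <= rho j.+1 -> `|u (x + t *: v) - u (x + s *: v)| <= K * p ^+ j.+1.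
Proof.
move=> v1 js st tj.
have /andP[hh hh1] := hj01 j.+1.
have s0 : 0 <= s by exact: le_trans js.
have oj : 0 < omega ((h ^+ j.+1 * r) `^ alpha).
  by case: maj => _ _ _ + _; apply; rewrite powR_gt0 ?mulr_gt0//; lra.
have := @C1_mvt R n (eball 0 1) u x v s t (M / omega ((h ^+ j.+1 * r) `^ alpha)).
rewrite v1 mulr1 => H; apply: le_trans (H _ C1u st _) _ => [|w /andP[sw wt]|].
- exact: open_eball.
- have w0 : 0 <= w by exact: le_trans sw.
  have dw : h ^+ j.+1 * r <= dist_bd (x + w *: v).
    have := enormD x (w *: v); rewrite enormZ v1 mulr1 ger0_norm// => Hw.
    have /andP[_] := rd; rewrite /dist_bd.
    have : w <= rho j.+1 by exact: le_trans tj.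
    by rewrite /rho; lra.
  have Aw : eball 0 1 (x + w *: v).
    rewrite /eball/= subr0 -subr_gt0; apply: lt_le_trans dw.
    by rewrite mulr_gt0//; lra.
  split => //; rewrite ler_pdivlMr//; apply: le_trans (bloch _ Aw).
  rewrite ler_wpM2l ?enorm_ge0//; apply: majorant_homo => //.
  by rewrite dw andbT mulr_ge0 ?(ltW r0)//; lra.
- apply: (@le_trans _ _ (M / ((h `^ alpha) ^+ j.+1 * omega (r `^ alpha)) * (h ^+ j.+1 * r))).
    apply: ler_pM; rewrite ?subr_ge0 ?divr_ge0 ?(ltW oj)//.
      rewrite ler_wpM2l// lef_pV2 ?posrE ?mulr_gt0 ?exprn_gt0 ?powR_gt0//.
      rewrite -powR_exprn ?(ltW h0)//; apply: majorant_powR_scale => //.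
    rewrite (_ : h ^+ j.+1 * r = rho j.+1 - rho j); first by lra.
    have hE : h * 2 = 1 by rewrite /h mulVf.
    rewrite /rho (_ : h ^+ j = h ^+ j.+1 * 2); first by ring.
    by rewrite exprS mulrAC hE mul1r.
  rewrite le_eqVlt; apply/orP; left; apply/eqP.
  rewrite /K /p expr_div_n; field.
  by rewrite !gt_eqF ?exprn_gt0 ?powR_gt0.
Qed.

(** Induction on the number of shells crossed. The indicator makes a point pay for shell [j] only if
    it lies beyond [rho j]; integration will turn it into a volume. *)
Let osc_shells (v : 'rV[R]_n) J (t : R) : enorm v = 1 -> 0 <= t <= rho J ->
  `|u (x + t *: v) - u x| <= \sum_(0 <= j < J) K * p ^+ j.+1 * (rho j <= t)%R%:R.
Proof.
move=> v1; elim: J t => [|J IH] t /andP[t0 tJ].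
  have -> : t = 0 by move: tJ; rewrite /rho expr0 subrr mul0r; lra.
  by rewrite scale0r addr0 subrr normr0 big_nil.
rewrite big_nat_recr//=; have [rt|tr] := leP (rho J) t; last first.
  by rewrite mulr0 addr0 IH// t0 ltW.
have rJ0 := rho_ge0 J.
rewrite mulr1 (_ : u _ - u x = (u (x + rho J *: v) - u x) +
   (u (x + t *: v) - u (x + rho J *: v))); last by ring.
apply: le_trans (ler_normD _ _) _; apply: lerD; last exact: rho_step.
apply: le_trans (IH _ _) _; first by rewrite rJ0 lexx.
apply: ler_sum => j _; rewrite ler_wpM2l ?Kp0//.
have [jJ|//] := leP (rho j) (rho J).
by rewrite (le_trans jJ rt).
Qed.

(** The whole ball beyond radius [rho j], not just the shell up to [rho j.+1]: a point pays for
    every shell between it and the centre. *)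
Let N j : set (n.-tuple (measurableTypeR R)) :=
  row_of_tuple @^-1` (eball x r `\` eball x (rho j)).

Let mN j : measurable (N j).
Proof.
exact: (measurableD (measurable_eball x r) (measurable_eball x (rho j))).
Qed.

Let osc_series t : (row_of_tuple @^-1` eball x r) t ->
  (`|u (row_of_tuple t) - u x|%:E <=
   \sum_(j <oo) (K * p ^+ j.+1)%:E * (\1_(N j) t)%:E)%E.
Proof.
move=> Bt; set y := row_of_tuple t; set s := enorm (y - x).
have sr : s < r by exact: Bt.
(* At the centre there is no direction [v], but the left side is 0. *)
have [s0|s0] := eqVneq s 0.
  have /enorm_eq0/eqP := s0; rewrite subr_eq0 => /eqP ->.
  rewrite subrr normr0; apply: nneseries_ge0 => j _ _.
  by rewrite mule_ge0// lee_fin Kp0.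
have s0' : 0 < s by rewrite lt_neqAle eq_sym s0 enorm_ge0.
pose v := s^-1 *: (y - x).
have v1 : enorm v = 1 by rewrite enormZ gtr0_norm ?invr_gt0// mulVf.
have yE : y = x + s *: v by rewrite /v scalerA mulfV// scale1r addrC subrK.
(* [rho J] tends to [r > s], so finitely many shells suffice; the other terms of the series are
   nonnegative. *)
have [J sJ] : exists J, s <= rho J.
  have : (h ^+ J) @[J --> \oo] --> (0 : R).
    by apply: cvg_expr; rewrite ger0_norm ?(ltW h0)// /h; lra.
  have d0 : 0 < 1 - s / r by rewrite subr_gt0 ltr_pdivrMr// mul1r.
  move=> /cvgrPdist_le/(_ _ d0)[J _ /(_ J (leqnn J))/=].
  rewrite sub0r normrN ger0_norm ?exprn_ge0 ?(ltW h0)// => HJ.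
  exists J; rewrite /rho; rewrite -ler_pdivrMr//; lra.
apply: le_trans (nneseries_lim_ge J _); last first.
  by move=> j _ _; rewrite mule_ge0// lee_fin Kp0.
under eq_bigr do rewrite -EFinM.
rewrite sumEFin lee_fin {1}yE; apply: le_trans (osc_shells v J s v1 _) _.
  by rewrite sJ enorm_ge0.
apply: ler_sum => j _; rewrite ler_wpM2l ?Kp0// indicE.
case: (leP (rho j) s) => //= js; rewrite mem_set//; split => //.
by rewrite /eball/= -/y -/s => ?; lra.
Qed.

(** Termwise integration of [osc_series]: term [j] is at most [K p n (p h)^j] times the volume of
    the ball, a geometric series. *)
Lemma oscillation_le :
  (ball_mean x r (fun y => `|u y - u x|%R) <=
   (n%:R * p / (1 - p * h) * M * r / omega (r `^ alpha))%R%:E)%E.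
Proof.
have V0 : 0 < r ^+ n * @uvol R n by rewrite mulr_gt0 ?uvol_gt0// exprn_gt0.
have mB := @measurable_eball R n x r.
have mu_ : measurable_fun (row_of_tuple @^-1` eball x r)
    (fun t => (`|u (row_of_tuple t) - u x|)%:E).
  apply/measurable_EFinP.
  apply: (@measurable_row_cont R n (eball x r) (fun y => `|u y - u x|)).
    exact: open_eball.
  move=> y By; apply: (@continuous_comp _ _ _ (fun y => u y - u x) Num.norm).
    apply: continuousB; last exact: cst_continuous.
    case: C1u => + _; apply; move: By; rewrite /eball/= subr0 => By.
    have := enormD x (y - x); rewrite addrC subrK.
    by move: rd; rewrite /dist_bd => /andP[_]; lra.
  exact: norm_continuous.
rewrite /ball_mean volumeE// inver (gt_eqF V0) -[leRHS]mul1e.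
rewrite (_ : 1%E = ((r ^+ n * @uvol R n)^-1%:E * (r ^+ n * @uvol R n)%:E)%E); last first.
  by rewrite -EFinM mulVf ?gt_eqF.
rewrite -muleA lee_wpmul2l ?lee_fin ?invr_ge0 ?(ltW V0)//.
have mF j : measurable_fun (row_of_tuple @^-1` eball x r)
    (fun t => ((K * p ^+ j.+1)%:E * (\1_(N j) t)%:E)%E).
  under eq_fun do rewrite -EFinM; apply/measurable_EFinP/measurable_funM => //.
have F0 j t : (0 <= (K * p ^+ j.+1)%:E * (\1_(N j) t)%:E)%E.
  by rewrite mule_ge0// lee_fin Kp0.
apply: le_trans.
  apply: (@ge0_le_integral _ _ _ (lebesgue_pow n) _ mB _
    (fun t => \sum_(j <oo) (K * p ^+ j.+1)%:E * (\1_(N j) t)%:E)%E) => //.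
  exact: ge0_emeasurable_sum.
rewrite integral_nneseries//.
have C0 : 0 <= K * p * n%:R * (r ^+ n * @uvol R n).
  by rewrite mulr_ge0 ?(ltW V0)// mulr_ge0// mulr_ge0.
apply: le_trans.
  apply: (@lee_nneseries _ _ (fun j => (K * p * n%:R * (r ^+ n * @uvol R n) * (p * h) ^+ j)%:E)).
    by move=> j _ _; apply: integral_ge0.
  move=> j _; rewrite ge0_integralZl_EFin ?Kp0//; last first.
    by apply/measurable_EFinP; exact: measurable_indic.
  rewrite integral_indic// (_ : N j `&` _ = N j); last first.
    by apply: setIidl => t [].
  apply: (@le_trans _ _ ((K * p ^+ j.+1)%:E * (n%:R * h ^+ j * (r ^+ n * @uvol R n))%:E)%E).
    rewrite lee_wpmul2l ?lee_fin ?Kp0//.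
    by apply: volume_shell => //; have /andP[? ->] := hj01 j; rewrite ltW.
  rewrite -EFinM lee_fin (exprMn _ p h) (exprS p j) le_eqVlt.
  by apply/orP; left; apply/eqP; ring.
apply: lime_le.
  apply: is_cvg_nneseries => j _ _; rewrite lee_fin mulr_ge0// exprn_ge0//.
  by case/andP: ph1.
apply: nearW => J; rewrite sumEFin lee_fin -mulr_sumr.
apply: le_trans.
  apply: ler_wpM2l; last exact: geometric_sum_le ph1.
  exact: C0.
rewrite le_eqVlt; apply/orP; left; apply/eqP; rewrite /K; field.
by rewrite gt_eqF//= gt_eqF// subr_gt0; case/andP: ph1.
Qed.

End one_ball.

End bloch_to_oscillation.

(** * Integration by parts *)

Section integration.
Context {R : realType} {n : nat}.
Implicit Types (f g : 'rV[R]_n -> R) (x y v : 'rV[R]_n) (r s M : R).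
Local Notation mu := (lebesgue_pow n).

Definition rint f : R := Rintegral mu setT (f \o row_of_tuple).

Definition supported x s f : Prop := forall y, s <= enorm (y - x) -> f y = 0.

Definition row_integrable f := mu.-integrable setT (EFin \o (f \o row_of_tuple)).

Lemma measurable_row f : continuous f -> measurable_fun setT (f \o row_of_tuple).
Proof.
move=> cf; have := @measurable_row_cont R n setT f openT.
by rewrite preimage_setT; apply=> y _; exact: cf.
Qed.

Lemma integrable_ball x s M : mu.-integrable setT
  (EFin \o (fun t => M * \1_(row_of_tuple @^-1` eball x s) t)).
Proof.
have mB := @measurable_eball R n x s.
rewrite (_ : EFin \o _ =
  (fun t => M%:E * (\1_(row_of_tuple @^-1` eball x s) t)%:E)%E)//.
apply: integrableZl => //; apply/integrableP; split.
  by apply/measurable_EFinP; exact: measurable_indic.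
under eq_integral do rewrite gee0_abs ?lee_fin//.
rewrite integral_indic// setIT.
have [s0|s0] := ltP 0 s; last first.
  rewrite (_ : _ @^-1` _ = set0) ?measure0//.
  rewrite -subset0 => t /=; rewrite /eball/= => H.
  by have := le_lt_trans (enorm_ge0 _) H; rewrite ltNge s0.
suff : (volume (eball x s) < +oo)%E by [].
by rewrite volumeE// ltry.
Qed.

(** Extreme value theorem on a closed ball; [Num.max s 0] keeps this ball nonempty when [s] is
    negative. *)
Lemma supported_bounded x s f : continuous f -> supported x s f ->
  exists2 M, 0 <= M & forall y, `|f y| <= M.
Proof.
move=> cf sf; pose B := [set y : 'rV[R]_n | enorm (y - x) <= Num.max s 0].
have Bx : B x by rewrite /B/= subrr enorm0 le_max lexx orbT.
have cB : compact B.
  apply: bounded_closed_compact; last exact: closed_eball.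
  rewrite /bounded_set/=; exists (`|x| + (Num.max s 0 + 1)); split; first exact: num_real.
  move=> K xK y By; apply: le_trans (ltW xK).
  rewrite -(subrK x y) addrC; apply: le_trans (ler_normD _ _) _; rewrite lerD2l.
  apply/ltW/norm_rv_lt => [|i]; first by rewrite ltr_wpDl// le_max lexx orbT.
  by apply: le_lt_trans (coord_le_enorm _ _) _; rewrite ltr_pwDr.
have [c _ Hc] := @EVT_max_rV R n (fun y => `|f y|) B (ex_intro _ _ Bx) cB
  (continuous_subspaceT (fun y => continuous_comp (cf y) (@norm_continuous _ _ _))).
exists `|f c| => // y; have [yB|yB] := leP (enorm (y - x)) (Num.max s 0).
  by apply: Hc; rewrite inE.
rewrite sf ?normr0//; apply: le_trans (ltW yB).
by rewrite le_max lexx.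
Qed.

Lemma row_integrable_supported x s f : continuous f -> supported x s f ->
  row_integrable f.
Proof.
move=> cf sf; have [M M0 HM] := supported_bounded x s f cf sf.
apply: (@le_integrable _ _ _ mu setT measurableT _
   (EFin \o (fun t => M * \1_(row_of_tuple @^-1` eball x s) t))).
- by apply/measurable_EFinP; exact: measurable_row.
- move=> t _; rewrite /= lee_fin normrM (ger0_norm M0).
  rewrite indicE; have [ts|st] := ltP (enorm (row_of_tuple t - x)) s.
    by rewrite mem_set// normr1 mulr1.
  by rewrite sf// normr0 mulr_ge0.
- exact: integrable_ball.
Qed.

Lemma rintD f g : row_integrable f -> row_integrable g ->
  rint (fun y => f y + g y) = rint f + rint g.
Proof. by move=> If Ig; rewrite /rint -RintegralD. Qed.

Lemma rintZ (c : R) f : row_integrable f -> rint (fun y => c * f y) = c * rint f.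
Proof. by move=> If; rewrite /rint -RintegralZl. Qed.

Lemma rint_sum m (F : 'I_m -> 'rV[R]_n -> R) : (forall i, row_integrable (F i)) ->
  row_integrable (fun y => \sum_(i < m) F i y) /\
  rint (fun y => \sum_(i < m) F i y) = \sum_(i < m) rint (F i).
Proof.
elim: m F => [|m IH] F IF.
  have -> : (fun y => \sum_(i < 0) F i y) = cst 0.
    by apply/funext => y; rewrite big_ord0.
  split; first exact: integrable0.
  by rewrite big_ord0 /rint /Rintegral integral0.
have [I1 E1] := IH (fun i => F (lift ord0 i)) (fun i => IF _).
have -> : (fun y => \sum_(i < m.+1) F i y) =
    (fun y => F ord0 y + \sum_(i < m) F (lift ord0 i) y).
  by apply/funext => y; rewrite big_ord_recl.
split; last by rewrite rintD// E1 big_ord_recl.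
exact: (integrableD measurableT (IF ord0) I1).
Qed.

Lemma rint_shift f v : row_integrable (fun y => f (v + y)) ->
  measurable_fun setT (f \o @row_of_tuple R n) ->
  rint (fun y => f (v + y)) = rint f.
Proof.
move=> If mf; pose phi := affine_tuple (tuple_of_row v) 1.
have mphi : measurable_fun setT phi by exact: measurable_affine_tuple.
have E t : row_of_tuple (phi t) = v + row_of_tuple t.
  by rewrite row_affine_tuple tuple_of_rowK scale1r.
rewrite /rint /Rintegral; congr fine.
transitivity (\int[pushforward mu phi]_(t in setT) (f (row_of_tuple t))%:E)%E.
  rewrite integral_pushforward//; last 2 first.
  - exact/measurable_EFinP.
  - by rewrite preimage_setT; apply: eq_integrable If => // t _ /=; rewrite E.
  by rewrite preimage_setT; apply: eq_integral => t _ /=; rewrite E.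
apply: eq_measure_integral => A mA _.
have := lebesgue_pow_affine n (tuple_of_row v) 1 (@ltr01 R) A mA.
by rewrite expr1n mul1e.
Qed.

Lemma enorm_delta (i : 'I_n) : enorm (delta_mx 0 i : 'rV[R]_n) = 1.
Proof.
rewrite /enorm (bigD1 i)//= big1 ?addr0 => [|j ji].
  by rewrite mxE !eqxx expr1n sqrtr1.
by rewrite mxE (negbTE ji) andbF expr0n.
Qed.

(* By translation invariance [h |-> rint (f (h e_i + .))] is constant. *)
Lemma rint_partial x s f f' (i : 'I_n) :
  continuous f -> continuous f' -> supported x s f -> supported x s f' ->
  (forall y, is_derive y (delta_mx 0 i) f (f' y)) -> rint f' = 0.
Proof.
move=> cf cf' sf sf' df.
pose e : 'rV[R]_n := delta_mx 0 i.
pose g (h : R) (t : n.-tuple (measurableTypeR R)) := f (h *: e + row_of_tuple t).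
have [M M0 HM] := supported_bounded x s f' cf' sf'.
have cfs h : continuous (fun y => f (h *: e + y)).
  move=> y; apply: continuous_comp; last exact: cf.
  by apply: continuousD; [exact: cst_continuous|exact: cvg_id].
have ig (h : R) : row_integrable (fun y => f (h *: e + y)).
  apply: (row_integrable_supported (x - h *: e) s); first exact: cfs.
  move=> y Hy; apply: sf; apply: le_trans Hy _.
  by rewrite opprB addrA (addrC (h *: e)) addrAC.
have dg (h : R) t : is_derive h 1 (g ^~ t) (f' (h *: e + row_of_tuple t)).
  have -> : g ^~ t = (fun h => f (row_of_tuple t + h *: e)).
    by apply/funext => k; rewrite /g addrC.
  by apply: (is_derive_line f (row_of_tuple t) e h _).1; rewrite addrC.
have a1 : (`]-1, 1[%classic : set R) 0 by rewrite /= in_itv/= ltrN10 ltr01.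
have Fc : (fun h => Rintegral mu setT (g h)) = cst (rint f).
  apply/funext => h; rewrite -[LHS]/(rint (fun y => f (h *: e + y))).
  by rewrite rint_shift//; exact: measurable_row.
(* For [|h| < 1] the translates of [f'] all vanish outside the ball of radius [s + 1], so [M] times
   its indicator dominates. *)
have := @differentiation_under_integral R _ _ mu g setT measurableT 0 (-1) 1 a1
  (fun h _ => ig h) (fun h t _ _ => @ex_derive _ _ _ _ _ _ _ (dg h t))
  (fun t => M * \1_(row_of_tuple @^-1` eball x (s + 1)) t) _
  (integrable_ball x (s + 1) M) _.
rewrite Fc derive1_cst => H.
rewrite /rint (_ : Rintegral mu setT _ =
  \int[mu]_(t in setT) (partial1of2 g ^~ t) 0).
  apply/esym/H => [t|h t hI _]; first by rewrite mulr_ge0.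
  rewrite partial1of2E derive_val.
  rewrite indicE; have [ts|st] := ltP (enorm (row_of_tuple t - x)) (s + 1).
    by rewrite mem_set// mulr1.
  rewrite sf' ?normr0 ?mulr_ge0//.
  have := enormD (h *: e + row_of_tuple t - x) (- (h *: e)).
  rewrite enormN enormZ enorm_delta mulr1.
  rewrite (_ : h *: e + row_of_tuple t - x - h *: e = row_of_tuple t - x); last first.
    by rewrite addrAC [h *: e + _]addrC addrK.
  have : `|h| < 1 by rewrite ltr_norml; move: hI; rewrite /= in_itv.
  lra.
apply: eq_Rintegral => t _ /=.
by rewrite partial1of2E derive_val scale0r add0r.
Qed.

End integration.

Section by_parts.
Context {R : realType} {n : nat}.
Implicit Types (f g : 'rV[R]_n -> R) (x y v : 'rV[R]_n) (r s : R) (A : set 'rV[R]_n).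

Lemma near_far x y s : s < enorm (y - x) -> \forall z \near y, s < enorm (z - x).
Proof.
move=> sy; have := @continuous_enormB R n x y.
rewrite /continuous_at => /cvgrPdist_lt/(_ (enorm (y - x) - s)).
rewrite subr_gt0 => /(_ sy); apply: filterS => z.
by rewrite ltr_norml => /andP[_]; lra.
Qed.

(** On the closed ball both factors are continuous; off it the product is zero near each point,
    whatever the values of [f] there. *)
Lemma continuous_mul_supported A x s f g : (forall y, enorm (y - x) <= s -> A y) ->
  (forall y, A y -> {for y, continuous f}) -> continuous g -> supported x s g ->
  continuous (fun y => f y * g y).
Proof.
move=> sA cf cg sg y; have [ys|sy] := leP (enorm (y - x)) s.
  by apply: (@continuousM _ _ f g); [exact/cf/sA|exact: cg].
have E : \forall z \near y, 0 = f z * g z.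
  by apply: filterS (near_far _ _ _ sy) => z sz; rewrite sg ?mulr0// ltW.
rewrite /continuous_at sg ?mulr0 ?(ltW sy)//.
exact: cvg_trans (near_eq_cvg E) (@cvg_cst _ _ _ _ _).
Qed.

Lemma supportedM x s f g : supported x s g -> supported x s (fun y => f y * g y).
Proof. by move=> sg y ys; rewrite sg ?mulr0. Qed.

(* [f] and [f'] are arbitrary outside [A], where [g] and [g'] vanish. *)
Lemma rint_by_parts A x s f f' g g' (i : 'I_n) :
  (forall y, enorm (y - x) <= s -> A y) ->
  (forall y, A y -> {for y, continuous f}) ->
  (forall y, A y -> {for y, continuous f'}) ->
  (forall y, A y -> is_derive y (delta_mx 0 i) f (f' y)) ->
  continuous g -> continuous g' -> supported x s g -> supported x s g' ->
  (forall y, is_derive y (delta_mx 0 i) g (g' y)) ->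
  rint (fun y => f' y * g y) = - rint (fun y => f y * g' y).
Proof.
move=> sA cf cf' df cg cg' sg sg' dg.
have c1 := continuous_mul_supported _ _ _ _ _ sA cf' cg sg.
have c2 := continuous_mul_supported _ _ _ _ _ sA cf cg' sg'.
have c0 := continuous_mul_supported _ _ _ _ _ sA cf cg sg.
have I1 := row_integrable_supported x s _ c1 (supportedM _ _ f' _ sg).
have I2 := row_integrable_supported x s _ c2 (supportedM _ _ f _ sg').
apply/eqP; rewrite -subr_eq0 opprK -rintD//; apply/eqP.
apply: (@rint_partial _ _ x s (fun y => f y * g y) _ i) => //.
- by move=> y; apply: (@continuousD _ _ _ (fun y => f' y * g y)); [exact: c1|exact: c2].
- exact: supportedM.
- by move=> y ys; rewrite (supportedM _ _ f' _ sg _ ys) (supportedM _ _ f _ sg' _ ys) addr0.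
- move=> y; have [ys|sy] := leP (enorm (y - x)) s.
    have := @is_deriveM _ _ f g y (delta_mx 0 i) (f' y) (g' y) (df y (sA y ys)) (dg y).
    move/is_derive_eq; apply; rewrite /GRing.scale/=; ring.
  rewrite sg ?sg' ?(ltW sy)// !mulr0 addr0.
  apply: (@near_eq_is_derive _ _ _ (cst 0)).
    by apply: filterS (near_far _ _ _ sy) => z sz; rewrite sg ?mulr0// ltW.
Qed.

End by_parts.
Arguments continuous_mul_supported {R n A x s f g}.
Arguments supportedM {R n x s f g}.

(** * Green's formula for the kernels *)

Section pospow.
Context {R : realType}.

(** The power [t_+^k], except that exponent 0 gives the constant 1 and not an indicator; hence the
    shifted exponents [k.+1] and [k.+2] in the lemmas. *)
Definition pospow (k : nat) (t : R) : R := Num.max t 0 ^+ k.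

Lemma pospow_ge0 k t : 0 <= pospow k t.
Proof. by rewrite exprn_ge0// le_max lexx orbT. Qed.

Lemma pospowS k t : pospow k.+2 t = t * pospow k.+1 t.
Proof.
rewrite /pospow exprS; have [t0|t0] := leP t 0; last by [].
by rewrite exprS !mul0r mulr0.
Qed.

Lemma continuous_pospow k : continuous (pospow k).
Proof.
move=> t; apply: (@continuous_comp _ _ _ (fun t : R => Num.max t 0) (fun r => r ^+ k)).
  apply: (@continuous_max _ _ id (cst 0)); [exact: cvg_id|exact: cst_continuous].
exact: exprn_continuous.
Qed.

(** The kink at 0 is dealt with here: the linearization error is at most [h^2] whatever the signs of
    [t] and [h + t]. Higher exponents then follow from [pospowS] and the product rule. *)
Lemma is_derive_pospow2 (t : R) : is_derive t 1 (pospow 2) (2 * pospow 1 t).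
Proof.
have H : h^-1 *: (pospow 2 (h *: (1 : R) + t) - pospow 2 t) @[h --> 0^'] --> 2 * pospow 1 t.
  apply/cvgrPdist_le => e e0.
  have N1 : \forall h \near (0 : R)^', h != 0 by exact: nbhs_dnbhs_neq.
  have N2 : \forall h \near (0 : R)^', `|h| < e.
    exact: dnbhs0_lt.
  move: N1 N2; apply: filterS2 => h h0 he.
  rewrite -(ler_pM2l (_ : 0 < `|h|)) ?normr_gt0// -normrM mulrBr.
  rewrite [_ *: (_ - _)]/(_ * _) mulVKf//.
  rewrite [h%:A]mulr1 /pospow expr1.
  apply: (@le_trans _ _ (`|h| * `|h|)); last by rewrite ler_wpM2l// ltW.
  rewrite -normrM -expr2 (ger0_norm (sqr_ge0 h)) ler_norml.
  by case: (leP (h + t) 0) => ?; case: (leP t 0) => ?; apply/andP; split; nra.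
by apply: DeriveDef; [apply/cvg_ex; eexists; exact: H|exact: cvg_lim].
Qed.

Lemma is_derive_pospow k (t : R) :
  is_derive t 1 (pospow k.+2) (k.+2%:R * pospow k.+1 t).
Proof.
elim: k => [|k IH]; first exact: is_derive_pospow2.
have -> : pospow k.+3 = id \* pospow k.+2 by apply/funext => r; rewrite pospowS.
have := @is_deriveM _ _ id (pospow k.+2) t 1 1 _ (is_derive_id _ _) IH.
move/is_derive_eq; apply; rewrite /GRing.scale/= mulr1 mulrCA -pospowS -[k.+3%:R]natr1.
by ring.
Qed.

End pospow.

Section kernel.
Context {R : realType} {n : nat}.
Implicit Types (x y : 'rV[R]_n) (s : R).

(* [zc], [wt] and [wbump x s k] are [z_i], [w] and [w_+^k] in the notation of the
   opening comment. *)
Definition zc x (i : 'I_n) y : R := y 0 i - x 0 i.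

Definition wt x s y : R := s ^+ 2 - \sum_(i < n) zc x i y ^+ 2.

Definition wbump x s k y : R := pospow k (wt x s y).

Lemma continuous_zc x i : continuous (zc x i).
Proof. exact: continuous_coordB. Qed.

Lemma continuous_wt x s : continuous (wt x s).
Proof.
move=> y; apply: (@continuousB _ _ _ (cst (s ^+ 2))); first exact: cst_continuous.
exact: continuous_enorm_sqr.
Qed.

Lemma continuous_wbump x s k : continuous (wbump x s k).
Proof.
move=> y; apply: (@continuous_comp _ _ _ (wt x s) (pospow k)).
  exact: continuous_wt.
exact: continuous_pospow.
Qed.

Lemma wtE x s y : wt x s y = s ^+ 2 - enorm (y - x) ^+ 2.
Proof. by rewrite /wt enorm_sqr; under [in RHS]eq_bigr do rewrite !mxE. Qed.

Lemma supported_wbump x s k : 0 <= s -> supported x s (wbump x s k.+1).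
Proof.
move=> s0 y sy; rewrite /wbump /pospow wtE max_r ?expr0n//.
by rewrite subr_le0 ler_pXn2r ?nnegrE ?enorm_ge0.
Qed.

Lemma wbump_ge0 x s k y : 0 <= wbump x s k y.
Proof. exact: pospow_ge0. Qed.

Lemma wbumpS x s k y : wbump x s k.+2 y = wt x s y * wbump x s k.+1 y.
Proof. exact: pospowS. Qed.

Lemma wbump_le x s k y : wbump x s k y <= s ^+ (2 * k).
Proof.
rewrite exprM /wbump /pospow lerXn2r ?nnegrE ?le_max ?lexx ?orbT ?sqr_ge0//.
by rewrite ge_max sqr_ge0 andbT wtE gerBl sqr_ge0.
Qed.

Lemma zc_le x i y : `|zc x i y| <= enorm (y - x).
Proof. by have := coord_le_enorm (y - x) i; rewrite !mxE. Qed.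

Lemma is_derive_zc x i j y :
  is_derive y (delta_mx 0 i : 'rV[R]_n) (zc x j) (i == j)%:R.
Proof.
have E : (fun h : R => h^-1 *: (zc x j (h *: (delta_mx 0 i : 'rV[R]_n) + y) - zc x j y))
   = (fun h : R => h^-1 *: (h * (i == j)%:R)).
  by apply/funext => h; rewrite /zc !mxE eqxx/= eq_sym; congr (_ *: _); ring.
have H : h^-1 *: (zc x j (h *: (delta_mx 0 i : 'rV[R]_n) + y) - zc x j y)
    @[h --> 0^'] --> ((i == j)%:R : R).
  rewrite E; apply/cvgrPdist_le => e e0.
  have : \forall h \near (0 : R)^', h != 0 by exact: nbhs_dnbhs_neq.
  by apply: filterS => h h0; rewrite /GRing.scale/= mulKf// subrr normr0 ltW.
by apply: DeriveDef; [apply/cvg_ex; eexists; exact: H|exact: cvg_lim].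
Qed.

Lemma is_derive_wt x s i y :
  is_derive y (delta_mx 0 i : 'rV[R]_n) (wt x s) (- 2 * zc x i y).
Proof.
have D j := is_deriveM (is_derive_zc x i j y) (is_derive_zc x i j y).
have S := is_derive_sum D.
have := is_deriveB (is_derive_cst (s ^+ 2) y (delta_mx 0 i : 'rV[R]_n)) S.
have -> : cst (s ^+ 2) - \sum_(j < n) (zc x j * zc x j) = wt x s.
  apply/funext => z; rewrite /wt !fctE; congr (_ - _).
  by rewrite fct_sumE; apply: eq_bigr => j _; rewrite expr2.
move/is_derive_eq; apply; rewrite sub0r (bigD1 i)//= big1 => [|j ji].
  by rewrite eqxx /GRing.scale/=; ring.
by rewrite eq_sym (negbTE ji) scaler0 addr0.
Qed.

Lemma is_derive_wbump x s k i y :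
  is_derive y (delta_mx 0 i : 'rV[R]_n) (wbump x s k.+2)
    (- (2 * k.+2%:R) * (zc x i y * wbump x s k.+1 y)).
Proof.
have := is_derive_comp1 _ _ _ _ _ _ (is_derive_wt x s i y) (is_derive_pospow k (wt x s y)).
by move/is_derive_eq; apply; rewrite /wbump; ring.
Qed.

Lemma is_derive_wbump2 x s i y : is_derive y (delta_mx 0 i : 'rV[R]_n)
  (wbump x s 2) (- 4 * (zc x i y * wbump x s 1 y)).
Proof.
have := is_derive_wbump x s 0 i y; move/is_derive_eq; apply.
by congr (_ * _); rewrite -natrM.
Qed.

Lemma is_derive_wbump3 x s i y : is_derive y (delta_mx 0 i : 'rV[R]_n)
  (wbump x s 3) (- 6 * (zc x i y * wbump x s 2 y)).
Proof.
have := is_derive_wbump x s 1 i y; move/is_derive_eq; apply.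
by congr (_ * _); rewrite -natrM.
Qed.

End kernel.

Section green.
Context {R : realType} {n : nat}.
Implicit Types (x y : 'rV[R]_n) (s : R) (f : 'rV[R]_n -> R) (A : set 'rV[R]_n).

Lemma continuousMf f g : continuous f -> continuous g -> continuous (fun y => f y * g y).
Proof. by move=> cf cg y; apply: continuousM; [exact: cf|exact: cg]. Qed.

Lemma continuousDf f g : continuous f -> continuous g -> continuous (fun y => f y + g y).
Proof. by move=> cf cg y; apply: (@continuousD _ _ _ f g); [exact: cf|exact: cg]. Qed.

Lemma continuousZf (c : R) f : continuous f -> continuous (fun y => c * f y).
Proof. by move=> cf; apply: continuousMf => //; exact: cst_continuous. Qed.

Lemma continuous_zbump x s e k : continuous (fun y => zc x e y * wbump x s k y).
Proof. by apply: continuousMf; [exact: continuous_zc|exact: continuous_wbump]. Qed.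

Lemma supported_zbump x s e k : 0 <= s ->
  supported x s (fun y => zc x e y * wbump x s k.+1 y).
Proof. by move=> s0; apply: supportedM; exact: supported_wbump. Qed.

Lemma row_integrable_zbump A x s e k f : 0 <= s ->
  (forall y, enorm (y - x) <= s -> A y) ->
  (forall y, A y -> {for y, continuous f}) ->
  row_integrable (fun y => f y * (zc x e y * wbump x s k.+1 y)).
Proof.
move=> s0 sA cf; apply: (row_integrable_supported x s).
  exact: (continuous_mul_supported sA cf (continuous_zbump x s e k.+1)
           (supported_zbump x s e k s0)).
exact: supportedM (supported_zbump x s e k s0).
Qed.

(* [dpsi i] and [ddpsi i] are the first two derivatives of [psi] in direction [i]. *)
Definition psi x s e y : R := zc x e y * wbump x s 3 y.

Definition dpsi x s e i y : R :=
  (i == e)%:R * wbump x s 3 y + (-6) * (zc x e y * (zc x i y * wbump x s 2 y)).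

Definition ddpsi x s e i y : R :=
  (-12) * ((i == e)%:R * (zc x i y * wbump x s 2 y)) +
  ((-6) * (zc x e y * wbump x s 2 y) +
   24 * (zc x i y * (zc x i y * (zc x e y * wbump x s 1 y)))).

Lemma is_derive_psi x s e i y :
  is_derive y (delta_mx 0 i : 'rV[R]_n) (psi x s e) (dpsi x s e i y).
Proof.
have := is_deriveM (is_derive_zc x i e y) (is_derive_wbump3 x s i y).
by move/is_derive_eq; apply; rewrite /dpsi /GRing.scale/=; ring.
Qed.

Lemma is_derive_dpsi x s e i y :
  is_derive y (delta_mx 0 i : 'rV[R]_n) (dpsi x s e i) (ddpsi x s e i y).
Proof.
have D1 := is_deriveZ (i == e)%:R (is_derive_wbump3 x s i y).
have D2 := is_deriveM (is_derive_zc x i i y) (is_derive_wbump2 x s i y).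
have D3 := is_deriveZ (-6) (is_deriveM (is_derive_zc x i e y) D2).
have := is_deriveD D1 D3.
move/is_derive_eq; apply; rewrite /ddpsi /GRing.scale/= ?fctE /GRing.scale/= eqxx mulr1n.
by move: (i == e)%:R => b; ring.
Qed.

Lemma continuous_dpsi x s e i : continuous (dpsi x s e i).
Proof.
apply: continuousDf; first by apply: continuousZf; exact: continuous_wbump.
apply: continuousZf; apply: continuousMf; first exact: continuous_zc.
exact: continuous_zbump.
Qed.

Lemma continuous_ddpsi x s e i : continuous (ddpsi x s e i).
Proof.
apply: continuousDf; first by do 2 apply: continuousZf; exact: continuous_zbump.
apply: continuousDf; first by apply: continuousZf; exact: continuous_zbump.
apply: continuousZf; apply: continuousMf; first exact: continuous_zc.
by apply: continuousMf; [exact: continuous_zc|exact: continuous_zbump].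
Qed.

Lemma supported_dpsi x s e i : 0 <= s -> supported x s (dpsi x s e i).
Proof.
move=> s0 y ys; rewrite /dpsi (supported_wbump x s 2 s0 y ys).
by rewrite (supported_wbump x s 1 s0 y ys) !mulr0 addr0.
Qed.

(** The reason for the exponent 3 in [psi]: each term of its second derivatives still has a factor
    [w_+], so it is continuous and vanishes on the sphere. *)
Lemma supported_ddpsi x s e i : 0 <= s -> supported x s (ddpsi x s e i).
Proof.
move=> s0 y ys; rewrite /ddpsi (supported_wbump x s 1 s0 y ys).
by rewrite (supported_wbump x s 0 s0 y ys) !mulr0 !addr0.
Qed.

(** The Laplacian of [psi]. Replacing the sum of the [z_i^2] by [s^2 - w] leaves only multiples of
    [z_e w_+] and [z_e w_+^2]; the coefficients of the latter add up to
    [-12 - 6 n - 24 = -6 (n + 6)]. *)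
Lemma sum_ddpsi x s e y : \sum_(i < n) ddpsi x s e i y =
  6 * (- (n%:R + 6) * (zc x e y * wbump x s 2 y) +
       4 * s ^+ 2 * (zc x e y * wbump x s 1 y)).
Proof.
rewrite /ddpsi !big_split/=.
have -> : \sum_(i < n) (-6) * (zc x e y * wbump x s 2 y) =
    n%:R * ((-6) * (zc x e y * wbump x s 2 y)).
  by rewrite sumr_const card_ord mulr_natl.
rewrite -!mulr_sumr (bigD1 e)//= eqxx big1 ?addr0 ?mul1r => [|i /negbTE ->]; last by rewrite mul0r.
rewrite (_ : \sum_(i < n) zc x i y * (zc x i y * (zc x e y * wbump x s 1 y)) =
   (s ^+ 2 - wt x s y) * (zc x e y * wbump x s 1 y)); last first.
  rewrite /wt opprB addrC subrK mulr_suml; apply: eq_bigr => i _.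
  by rewrite mulrA -expr2.
by rewrite wbumpS; ring.
Qed.

(** Two integrations by parts in each coordinate, without boundary terms since [psi] and [dpsi]
    vanish on the sphere. *)
Lemma green A f x s e : C2_on A f -> 0 <= s ->
  (forall y, enorm (y - x) <= s -> A y) ->
  rint (fun y => laplacian f y * (zc x e y * wbump x s 3 y)) =
  6 * (- (n%:R + 6) * rint (fun y => f y * (zc x e y * wbump x s 2 y)) +
       4 * s ^+ 2 * rint (fun y => f y * (zc x e y * wbump x s 1 y))).
Proof.
move=> [[cf df] C1p] s0 sA.
have cp i y : A y -> {for y, continuous (partial i f)} by move=> Ay; have [] := df i y Ay.
have cpp i y : A y -> {for y, continuous (partial i (partial i f))}.
  by move=> Ay; have [_ /(_ i y Ay)[]] := C1p i.
have Df i y : A y -> is_derive y (delta_mx 0 i) f (partial i f y).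
  by move=> Ay; have [/derivableP] := df i y Ay.
have Dpf i y : A y -> is_derive y (delta_mx 0 i) (partial i f) (partial i (partial i f) y).
  by move=> Ay; have [_ /(_ i y Ay)[/derivableP]] := C1p i.
have step i : rint (fun y => partial i (partial i f) y * psi x s e y) =
    rint (fun y => f y * ddpsi x s e i y).
  have E1 := rint_by_parts A x s (partial i f) (partial i (partial i f)) (psi x s e)
    (dpsi x s e i) i sA (cp i) (cpp i) (Dpf i) (continuous_zbump x s e 3)
    (continuous_dpsi x s e i) (supported_zbump x s e 2 s0) (supported_dpsi x s e i s0)
    (is_derive_psi x s e i).
  have E2 := rint_by_parts A x s f (partial i f) (dpsi x s e i) (ddpsi x s e i) i
    sA cf (cp i) (Df i) (continuous_dpsi x s e i) (continuous_ddpsi x s e i)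
    (supported_dpsi x s e i s0) (supported_ddpsi x s e i s0) (is_derive_dpsi x s e i).
  by rewrite E1 E2 opprK.
have -> : (fun y => laplacian f y * (zc x e y * wbump x s 3 y)) =
   (fun y => \sum_(i < n) partial i (partial i f) y * psi x s e y).
  by apply/funext => y; rewrite /laplacian mulr_suml.
have I1 i : row_integrable (fun y => partial i (partial i f) y * psi x s e y).
  by apply: (row_integrable_zbump A) => //; exact: cpp.
have I2 i : row_integrable (fun y => f y * ddpsi x s e i y).
  apply: (row_integrable_supported x s).
    by apply: (continuous_mul_supported sA cf); [exact: continuous_ddpsi|exact: supported_ddpsi].
  by apply: supportedM; exact: supported_ddpsi.
rewrite (rint_sum _ _ I1).2 (eq_bigr _ (fun i _ => step i)) -(rint_sum _ _ I2).2.
have K k : row_integrable (fun y => f y * (zc x e y * wbump x s k.+1 y)).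
  exact: (row_integrable_zbump A).
have KZ k (c : R) : row_integrable (fun y => c * (f y * (zc x e y * wbump x s k.+1 y))).
  exact: (integrableZl measurableT c (K k)).
rewrite mulrDr !mulrA -!rintZ// -rintD//.
congr rint; apply/funext => y; rewrite -mulr_sumr sum_ddpsi; ring.
Qed.

(** Up to the factor [-2 (k+2)], the integrand is the [e]-th partial derivative of the compactly
    supported [w_+^(k+2)]. *)
Lemma rint_zbump x s e k : 0 <= s -> rint (fun y => zc x e y * wbump x s k.+1 y) = 0.
Proof.
move=> s0; have c0 : - (2 * k.+2%:R) != 0 :> R by rewrite oppr_eq0 mulf_neq0// pnatr_eq0.
apply: (mulfI c0); rewrite mulr0 -rintZ; last first.
  apply: (row_integrable_supported x s); first exact: continuous_zbump.
  exact: supported_zbump.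
apply: (rint_partial x s (wbump x s k.+2) _ e).
- exact: continuous_wbump.
- by apply: continuousZf; exact: continuous_zbump.
- exact: supported_wbump.
- by apply: supportedM; exact: supported_zbump.
- exact: is_derive_wbump.
Qed.

(** The integral of [dpsi] is 0. This is what singles out the [e]-th partial derivative in
    [P2_expand]. *)
Lemma rint_zzbump x s e i : 0 <= s ->
  rint (fun y => zc x i y * (zc x e y * wbump x s 2 y)) =
  (i == e)%:R * (rint (wbump x s 3) / 6).
Proof.
move=> s0.
have I3 : row_integrable (wbump x s 3).
  by apply: (row_integrable_supported x s); [exact: continuous_wbump|exact: supported_wbump].
have I2 : row_integrable (fun y => zc x i y * (zc x e y * wbump x s 2 y)).
  apply: (row_integrable_zbump setT) => // y _; exact: continuous_zc.
have := rint_partial x s (psi x s e) (dpsi x s e i) i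
  (continuous_zbump x s e 3) (continuous_dpsi x s e i)
  (supported_zbump x s e 2 s0) (supported_dpsi x s e i s0) (is_derive_psi x s e i).
have -> : dpsi x s e i = (fun y => (i == e)%:R * wbump x s 3 y +
    (-6) * (zc x i y * (zc x e y * wbump x s 2 y))).
  by apply/funext => y; rewrite /dpsi; ring.
rewrite rintD ?rintZ//; last 2 first.
- exact: (integrableZl measurableT _ I3).
- exact: (integrableZl measurableT _ I2).
by move=> H; lra.
Qed.

(** On the ball of half the radius [w] is at least [3/4 s^2], and [27/64] is the cube of [3/4]. *)
Lemma rint_wbump3_ge x s : 0 < s ->
  27 / 64 * s ^+ 6 * ((s / 2) ^+ n * @uvol R n) <= rint (wbump x s 3).
Proof.
move=> s0; have s20 : 0 < s / 2 by rewrite divr_gt0.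
have I3 : row_integrable (wbump x s 3).
  apply: (row_integrable_supported x s); first exact: continuous_wbump.
  by apply: supported_wbump; exact: ltW.
have Ib := integrable_ball x (s / 2) (27 / 64 * s ^+ 6).
have E : Rintegral (lebesgue_pow n) setT
    (fun t => 27 / 64 * s ^+ 6 * \1_(row_of_tuple @^-1` eball x (s / 2)) t) =
    27 / 64 * s ^+ 6 * ((s / 2) ^+ n * @uvol R n).
  have I1 := integrable_ball x (s / 2) 1.
  rewrite RintegralZl//; last first.
    by apply: eq_integrable I1 => // t _ /=; rewrite mul1r.
  congr (_ * _); rewrite /Rintegral integral_indic// ?setIT; last exact: measurable_eball.
  exact: (congr1 fine (volumeE x (s / 2) s20)).
rewrite -E; apply: le_Rintegral => // t _.
rewrite indicE; have [ts|st] := ltP (enorm (row_of_tuple t - x)) (s / 2); last first.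
  by rewrite memNset ?mulr0 ?wbump_ge0//= /eball/= ltNge st.
rewrite mem_set// mulr1 /= /wbump /pospow.
have /= w1 : 3 / 4 * s ^+ 2 <= wt x s (row_of_tuple t).
  rewrite wtE; have := enorm_ge0 (row_of_tuple t - x); nra.
have w0 : 0 <= 3 / 4 * s ^+ 2 by rewrite mulr_ge0// sqr_ge0.
rewrite max_l; last exact: le_trans w1.
rewrite (_ : _ * s ^+ 6 = (3 / 4 * s ^+ 2) ^+ 3); last by field.
by rewrite lerXn2r// nnegrE// (le_trans w0).
Qed.

Lemma wbump_homo x s r k y : 0 <= s <= r -> wbump x s k y <= wbump x r k y.
Proof.
move=> /andP[s0 sr].
have m0 t : 0 <= Num.max t 0 :> R by rewrite le_max lexx orbT.
rewrite /wbump /pospow; apply: lerXn2r; rewrite ?nnegrE ?m0// ge_max m0 andbT.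
rewrite le_max; apply/orP; left.
by rewrite !wtE lerD2r lerXn2r ?nnegrE// (le_trans s0).
Qed.

(** As a function of [s], [w_+^2] is differentiable even when the moving sphere passes through [y],
    with derivative [4 s w_+]; so differentiating under the integral yields no boundary term. Since
    [w_+] increases with [s], the larger radius [r] provides the dominating function. *)
Lemma is_derive_rint_zbump A f x e (s r : R) :
  (forall y, enorm (y - x) <= r -> A y) ->
  (forall y, A y -> {for y, continuous f}) -> 0 < s < r ->
  is_derive s 1 (fun s => rint (fun y => f y * (zc x e y * wbump x s 2 y)))
    (4 * s * rint (fun y => f y * (zc x e y * wbump x s 1 y))).
Proof.
move=> rA cf /andP[s0 sr].
pose g (h : R) (t : n.-tuple (measurableTypeR R)) :=
  f (row_of_tuple t) * (zc x e (row_of_tuple t) * wbump x h 2 (row_of_tuple t)).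
have hA h : h < r -> forall y, enorm (y - x) <= h -> A y.
  by move=> hr y yh; apply: rA; apply: le_trans yh (ltW hr).
have I h k : (`]0, r[%classic : set R) h ->
    row_integrable (fun y => f y * (zc x e y * wbump x h k.+1 y)).
  rewrite /= in_itv/= => /andP[h0 hr].
  by apply: (row_integrable_zbump A) => //; [exact: ltW|exact: hA].
have Is : (`]0, r[%classic : set R) s by rewrite /= in_itv/= s0.
have dg (h : R) t : is_derive h 1 (g ^~ t) (4 * h *
    (f (row_of_tuple t) * (zc x e (row_of_tuple t) * wbump x h 1 (row_of_tuple t)))).
  set y := row_of_tuple t; set c := f y * zc x e y.
  have D1 : is_derive h 1 (fun h : R => wt x h y) (2 * h).
    have := is_deriveB (is_deriveX 2 (is_derive_id h (1 : R)))
       (is_derive_cst (\sum_(i < n) zc x i y ^+ 2) h (1 : R)).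
    have -> : (fun h : R => wt x h y) =
        (@idfun R) ^+ 2 - cst (\sum_(i < n) zc x i y ^+ 2).
      by apply/funext => k; rewrite /wt !fctE.
    by move/is_derive_eq; apply; rewrite subr0 /GRing.scale/= mulr1 expr1.
  have D2 := is_derive_comp1 _ _ _ _ _ _ D1 (is_derive_pospow 0 (wt x h y)).
  have D3 := is_deriveM (is_derive_cst c h (1 : R)) D2.
  have gE : g ^~ t = cst c * (pospow 2 \o (fun h : R => wt x h y)).
    by apply/funext => k; rewrite /g -/y fctE /= /c mulrA.
  rewrite gE; move/is_derive_eq : D3; apply.
  by rewrite /GRing.scale/= /wbump /c; ring.
have d1 h t : partial1of2 g h t = 4 * h *
    (f (row_of_tuple t) * (zc x e (row_of_tuple t) * wbump x h 1 (row_of_tuple t))).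
  by rewrite partial1of2E; have [_] := dg h t.
pose G (t : n.-tuple (measurableTypeR R)) := `|4 * r *
    (f (row_of_tuple t) * (zc x e (row_of_tuple t) * wbump x r 1 (row_of_tuple t)))|.
have iG : (lebesgue_pow n).-integrable setT (EFin \o G).
  have Ir : row_integrable (fun y => f y * (zc x e y * wbump x r 1 y)).
    by apply: (row_integrable_zbump A) => //; apply: ltW; apply: lt_trans sr.
  exact: (integrable_norm (integrableZl measurableT (4 * r) Ir)).
have Gub h t : (`]0, r[%classic : set R) h -> setT t -> `|partial1of2 g h t| <= G t.
  rewrite /= in_itv/= => /andP[h0 hr] _; rewrite d1 /G !normrM.
  rewrite !(ger0_norm (wbump_ge0 _ _ _ _)) (gtr0_norm h0).
  rewrite (gtr0_norm (lt_trans h0 hr)).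
  apply: ler_pM; rewrite ?mulr_ge0 ?wbump_ge0 ?(ltW h0)//.
    by rewrite ler_wpM2l// ltW.
  rewrite ler_wpM2l// ler_wpM2l//; apply: wbump_homo.
  by rewrite !ltW.
have G0 t : 0 <= G t by exact: normr_ge0.
have ex h t : (`]0, r[%classic : set R) h -> setT t -> derivable (g ^~ t) h 1.
  by move=> _ _; have [] := dg h t.
have H1 := @derivable_under_integral R _ _ (lebesgue_pow n) g setT measurableT s 0 r Is
  (fun h hI => I h 1 hI) ex G G0 iG Gub.
have H2 := @differentiation_under_integral R _ _ (lebesgue_pow n) g setT measurableT s 0 r Is
  (fun h hI => I h 1 hI) ex G G0 iG Gub.
apply: DeriveDef; first exact: H1.
rewrite -derive1E [LHS]H2 -rintZ; last exact: I.
by apply: eq_Rintegral => t _ /=; rewrite d1.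
Qed.

End green.

Lemma is_derive_expV (R : realType) (m : nat) (s : R) : s != 0 ->
  is_derive s 1 (fun s : R => (s ^+ m.+1)^-1) (- (m.+1%:R / s ^+ m.+2)).
Proof.
move=> s0; have sn0 : s ^+ m.+1 != 0 by rewrite expf_neq0.
have := is_deriveX m.+1 (is_derive_id s (1 : R)).
have -> : (@idfun R) ^+ m.+1 = (fun s => s ^+ m.+1) by apply/funext => t; rewrite fctE.
move=> [De Dv].
pose f (t : R) := t ^+ m.+1.
apply: DeriveDef; first exact: (@derivableV _ _ f s 1 sn0 De).
have -> := @deriveV _ _ f s 1 sn0 De; rewrite Dv /f /GRing.scale/= mulr1.
rewrite !exprS; field.
by rewrite s0 expf_neq0.
Qed.

(** * Bounds of the kernel integrals by the integral of the absolute value over a ball *)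

Section bounds.
Context {R : realType} {n : nat}.
Implicit Types (x y : 'rV[R]_n) (s : R) (f : 'rV[R]_n -> R) (A : set 'rV[R]_n).
Local Notation mu := (lebesgue_pow n).

Definition ball_int x s f : \bar R :=
  (\int[mu]_(t in row_of_tuple @^-1` eball x s) (`|f (row_of_tuple t)|)%:E)%E.

Lemma measurable_ball_abs A x s f : (forall y, enorm (y - x) <= s -> A y) ->
  (forall y, A y -> {for y, continuous f}) ->
  measurable_fun (row_of_tuple @^-1` eball x s) (fun t => (`|f (row_of_tuple t)|)%:E).
Proof.
move=> sA cf; apply/measurable_EFinP.
apply: (@measurable_row_cont R n (eball x s) (fun y => `|f y|)).
  exact: open_eball.
move=> y By; apply: (@continuous_comp _ _ _ f Num.norm); last exact: norm_continuous.
by apply/cf/sA/ltW.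
Qed.

(** On the ball [z_e] is at most [s] in absolute value and [w_+] at most [s^2]; off it the kernel is
    0. *)
Lemma rint_zbump_le A x s e k f B : 0 <= s ->
  (forall y, enorm (y - x) <= s -> A y) ->
  (forall y, A y -> {for y, continuous f}) ->
  (ball_int x s f <= B%:E)%E ->
  `|rint (fun y => f y * (zc x e y * wbump x s k.+1 y))| <= s * s ^+ (2 * k.+1) * B.
Proof.
move=> s0 sA cf HB; set F := fun y => f y * _.
have IF : row_integrable F by exact: (row_integrable_zbump A).
have mF := measurable_int _ IF.
have mB := @measurable_eball R n x s.
set c := s * s ^+ (2 * k.+1); have c0 : 0 <= c by rewrite mulr_ge0// exprn_ge0.
rewrite -lee_fin /rint EFin_normr_Rintegral//.
apply: le_trans (le_abse_integral mu measurableT mF) _.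
have -> : (\int[mu]_t `|(EFin \o (F \o row_of_tuple)) t| =
    \int[mu]_(t in row_of_tuple @^-1` eball x s) `|(EFin \o (F \o row_of_tuple)) t|)%E.
  rewrite [RHS]integral_mkcond; apply: eq_integral => t _; rewrite /patch.
  case: ifPn => //; rewrite notin_setE /= /eball/= => /negP; rewrite -leNgt => st.
  by rewrite /F (supported_zbump x s e k s0 _ st) mulr0 normr0.
apply: (@le_trans _ _ (\int[mu]_(t in row_of_tuple @^-1` eball x s)
    (c%:E * (`|f (row_of_tuple t)|)%:E))%E).
  apply: ge0_le_integral => //.
  - by apply: measurableT_comp => //; exact: measurable_funTS mF.
  - by apply: measurable_funeM; exact: (measurable_ball_abs A).
  - move=> t Bt; rewrite /= lee_fin /F !normrM mulrC ler_wpM2r//.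
    rewrite (ger0_norm (wbump_ge0 _ _ _ _)); apply: ler_pM => //.
    + exact: wbump_ge0.
    + exact: le_trans (zc_le _ _ _) (ltW Bt).
    + exact: wbump_le.
rewrite ge0_integralZl_EFin//; last exact: (measurable_ball_abs A).
by rewrite (EFinM c B) lee_wpmul2l// lee_fin.
Qed.

End bounds.

(** * From the mean oscillation to the Bloch condition *)

Section oscillation_to_bloch.
Context {R : realType} {n : nat}.
Variables (omega : R -> R) (alpha lambda C : R) (u : 'rV[R]_n -> R).
Hypothesis alpha12 : 1 <= alpha < 2.
Hypothesis maj : majorant omega.
Hypothesis lambda0 : 0 <= lambda.
Hypothesis C0 : 0 < C.
Hypothesis C2u : C2_on (eball 0 1) u.
Hypothesis helm : forall x, eball 0 1 x -> laplacian u x = lambda * u x.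
Hypothesis osc : forall (x : 'rV[R]_n) (r : R), eball 0 1 x -> 0 < r <= dist_bd x ->
  (ball_mean x r (fun y => `|u y - u x|%R) <= (C * r / omega (r `^ alpha))%R%:E)%E.

Let h : R := 2^-1.
Let q : R := h `^ alpha.
Let V : R := @uvol R n.

Let h0 : 0 < h. Proof. by rewrite /h; lra. Qed.
Let h1 : h < 1. Proof. by rewrite /h; lra. Qed.
Let q0 : 0 < q. Proof. by rewrite powR_gt0. Qed.
Let V0 : 0 < V. Proof. exact: uvol_gt0. Qed.
Let alpha0 : 0 <= alpha.
Proof. by apply: le_trans ler01 _; case/andP: alpha12. Qed.
Let om0 r : 0 < r -> 0 < omega (r `^ alpha).
Proof. by move=> r0; case: maj => _ _ _ + _; apply; rewrite powR_gt0. Qed.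
Let C1u : C1_on (eball 0 1) u. Proof. by case: C2u. Qed.
Let cu y : eball 0 1 y -> {for y, continuous u}. Proof. by case: C1u => + _; exact. Qed.

Section one_point.
Variables (x : 'rV[R]_n) (e : 'I_n).
Hypothesis x1 : eball 0 1 x.
(** Half the distance leaves room to differentiate [Q] at [s0] itself; the price is a factor
    [2^alpha] in the final constant. *)
Let s0 : R := dist_bd x / 2.

Let d0 : 0 < dist_bd x.
Proof. by move: x1; rewrite /eball/= subr0 /dist_bd subr_gt0. Qed.
Let s00 : 0 < s0. Proof. by rewrite divr_gt0. Qed.
Let s01 : s0 <= 1.
Proof. by have := enorm_ge0 x; rewrite /s0 /dist_bd; lra. Qed.
Let sd : s0 < dist_bd x. Proof. by move: d0; rewrite /s0; lra. Qed.

Let inball s y : s < dist_bd x -> enorm (y - x) <= s -> eball 0 1 y.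
Proof.
move=> s1 ys; rewrite /eball/= subr0.
have := enormD x (y - x); rewrite addrC subrK.
by move: s1; rewrite /dist_bd; lra.
Qed.

Let P k s := rint (fun y => u y * (zc x e y * wbump x s k y)).
Let Q s := (s ^+ (n + 6))^-1 * P 2 s.

Let inball0 s : 0 < s <= s0 -> forall y, enorm (y - x) <= s -> eball 0 1 y.
Proof. by move=> /andP[_ ss] y; apply: inball; exact: le_lt_trans sd. Qed.

Let ball_osc s : 0 < s <= s0 -> (ball_int x s (fun y => (u y - u x)%R)
   <= (s ^+ n * V * (C * s / omega (s `^ alpha)))%:E)%E.
Proof.
move=> /andP[sp ss].
have sn : 0 < s ^+ n * V by rewrite mulr_gt0// exprn_gt0.
have sdx : 0 < s <= dist_bd x by rewrite sp (le_trans ss)// ltW.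
have := osc x s x1 sdx; rewrite /ball_mean volumeE// -/V inver (gt_eqF sn).
rewrite -/(ball_int x s (fun y => u y - u x)) => H.
rewrite EFinM -[leLHS]mul1e.
rewrite (_ : 1%E = ((s ^+ n * V)%:E * (s ^+ n * V)^-1%:E)%E); last first.
  by rewrite -EFinM mulfV ?gt_eqF.
by rewrite -muleA lee_wpmul2l// lee_fin ltW.
Qed.

Let P_le k s : 0 < s <= s0 -> `|P k.+1 s| <=
  s * s ^+ (2 * k.+1) * (s ^+ n * V * (C * s / omega (s `^ alpha))).
Proof.
move=> ss; have /andP[sp _] := ss; have sp' := ltW sp.
have sA := inball0 s ss.
have cux y : eball 0 1 y -> {for y, continuous (fun y => u y - u x)}.
  by move=> Ay; apply: continuousB; [exact: cu|exact: cst_continuous].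
have := rint_zbump_le (eball 0 1) x s e k (fun y => u y - u x) _ sp' sA cux (ball_osc s ss).
suff -> : rint (fun y => (u y - u x) * (zc x e y * wbump x s k.+1 y)) = P k.+1 s by [].
have -> : (fun y => (u y - u x) * (zc x e y * wbump x s k.+1 y)) =
   (fun y => u y * (zc x e y * wbump x s k.+1 y) +
     (- u x) * (1 * (zc x e y * wbump x s k.+1 y))).
  by apply/funext => y; ring.
have I1 : row_integrable (fun y => 1 * (zc x e y * wbump x s k.+1 y)).
  by apply: (row_integrable_zbump setT) => // y _; exact: cst_continuous.
rewrite rintD ?rintZ//.
- by rewrite rint_zbump// !mulr0 addr0.
- apply: (row_integrable_supported x s); first exact: continuous_zbump.
  exact: supported_zbump.
- exact: (row_integrable_zbump (eball 0 1)).
- exact: (integrableZl measurableT _ I1).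
Qed.

(** The exponent in [Q] matches the coefficient in [green]: [s^(n+7) Q' = s P_2' - (n+6) P_2], where
    [P_2' = 4 s P_1]. *)
Let is_derive_Q s : 0 < s <= s0 ->
  is_derive s 1 Q ((s ^+ (n + 7))^-1 * (lambda / 6 * P 3 s)).
Proof.
move=> ss'; have /andP[sp ss] := ss'.
have sA := inball0 s ss'.
have D1 : is_derive s 1 (P 2) (4 * s * P 1 s).
  (* Radius [3/2 * s0] is three quarters of [dist_bd x]: it exceeds every [s <= s0], and its closed
     ball stays in the unit ball. *)
  apply: (is_derive_rint_zbump (eball 0 1) u x e s (3 / 2 * s0)).
  - by move=> y; apply: inball; move: s00; rewrite /s0; lra.
  - exact: cu.
  - by rewrite sp; move: s00; lra.
have := green (eball 0 1) u x s e C2u (ltW sp) sA.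
have -> : rint (fun y => laplacian u y * (zc x e y * wbump x s 3 y)) = lambda * P 3 s.
  rewrite -rintZ; last by apply: (row_integrable_zbump (eball 0 1)) => //; exact: ltW.
  congr rint; apply/funext => y.
  (* The equation holds in the unit ball only; beyond radius [s] the kernel vanishes. *)
  have [ys|sy] := leP (enorm (y - x)) s; first by rewrite helm ?mulrA//; exact: sA.
  by rewrite (supported_zbump x s e 2 (ltW sp) y (ltW sy)) !mulr0.
rewrite -/(P 2 s) -/(P 1 s) => G.
have sn0 : s ^+ (n + 6) != 0 by rewrite expf_neq0// gt_eqF.
have D2 : is_derive s 1 (fun s : R => (s ^+ (n + 6))^-1)
   (- ((n + 6)%:R / s ^+ (n + 7))).
  by have := is_derive_expV R (n + 5) s; rewrite -!addnS; apply; rewrite gt_eqF.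
have D3 := is_deriveM D2 D1.
have -> : Q = (fun s : R => (s ^+ (n + 6))^-1) * P 2 by [].
move/is_derive_eq : D3; apply; rewrite /GRing.scale/=.
rewrite (_ : lambda / 6 * P 3 s = - (n%:R + 6) * P 2 s + 4 * s ^+ 2 * P 1 s); last by lra.
have -> : s ^+ (n + 7) = s * s ^+ (n + 6) by rewrite addnS exprS.
rewrite natrD; field.
by rewrite sn0 gt_eqF.
Qed.

Let w0 : R := omega (s0 `^ alpha).
Let w00 : 0 < w0. Proof. exact: om0. Qed.
Let L : R := lambda / 6 * V * C / w0.
(** [2^(alpha-2)], the ratio of successive bounds on the increments of [Q]. *)
Let z : R := h / q * h.

Let L0 : 0 <= L.
Proof. by rewrite /L !mulr_ge0 ?invr_ge0// ltW. Qed.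

Let z01 : 0 <= z < 1.
Proof. by apply: half_powR_ratio; case/andP: alpha12. Qed.

Let sj j : R := h ^+ j * s0.

Let sj_gt0 j : 0 < sj j.
Proof. by rewrite mulr_gt0// exprn_gt0. Qed.

Let hj1 j : h ^+ j <= 1.
Proof. by apply: exprn_ile1; exact: ltW. Qed.

Let sj_le j : sj j <= s0.
Proof. by rewrite ger_pMl. Qed.

(** The powers of [s] leave a single one: [1 + 6 + n + 1 - (n + 7) = 1]. *)
Let dQ_le s : 0 < s <= s0 -> `|(s ^+ (n + 7))^-1 * (lambda / 6 * P 3 s)| <=
  lambda / 6 * V * C * (s / omega (s `^ alpha)).
Proof.
move=> ss; have /andP[sp _] := ss; have os := om0 s sp.
have sn : 0 < s ^+ (n + 7) by rewrite exprn_gt0.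
rewrite normrM (gtr0_norm (_ : 0 < (s ^+ (n + 7))^-1)) ?invr_gt0//.
rewrite normrM (ger0_norm (_ : 0 <= lambda / 6)) ?mulr_ge0//.
apply: (@le_trans _ _ ((s ^+ (n + 7))^-1 * (lambda / 6 *
    (s * s ^+ (2 * 3) * (s ^+ n * V * (C * s / omega (s `^ alpha))))))).
  apply: ler_wpM2l; first by rewrite invr_ge0 ltW.
  by apply: ler_wpM2l; [rewrite mulr_ge0|exact: P_le].
rewrite le_eqVlt; apply/orP; left; apply/eqP.
have -> : s ^+ (n + 7) = s ^+ n * (s * s ^+ (2 * 3)) by rewrite exprD -exprS.
have snp := exprn_gt0 n sp; move: os snp sp; move: (s ^+ n) (omega _) => sn' os' osp snp sp'; field.
by rewrite !gt_eqF.
Qed.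

(** Between the two scales [t <= h^j], as [s0 <= 1], and [omega (t^alpha) >= q^(j+1) w0]. So [Q'] is
    at most [L h^j / q^(j+1)], on an interval of length at most [h^j]. *)
Let Q_step j : `|Q (sj j.+1) - Q (sj j)| <= L / q * z ^+ j.
Proof.
have hS : sj j.+1 = h * sj j by rewrite /sj exprS mulrA.
have sS : sj j.+1 <= sj j by rewrite hS ger_pMl// ltW.
have q1 : 0 < q ^+ j.+1 by rewrite exprn_gt0.
have oj : q ^+ j.+1 * w0 <= omega (sj j.+1 `^ alpha).
  rewrite -powR_exprn ?(ltW h0)//; apply: majorant_powR_scale => //.
  by rewrite exprn_gt0/=.
have := @mvt_approx R Q (fun s => (s ^+ (n + 7))^-1 * (lambda / 6 * P 3 s))
  (sj j) (sj j.+1) (L * (h ^+ j / q ^+ j.+1)) 0.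
rewrite mul0r subr0 min_r// max_l// => H.
apply: le_trans (H _) _ => [t /andP[t1 t2]|].
  have tp : 0 < t by exact: lt_le_trans t1.
  have ts : 0 < t <= s0 by rewrite tp (le_trans t2).
  split; first exact: is_derive_Q.
  rewrite subr0; apply: le_trans (dQ_le t ts) _.
  rewrite /L -[leRHS]mulrA; apply: ler_wpM2l.
    by rewrite !mulr_ge0// ltW.
  rewrite mulrCA -invfM; apply: ler_pM.
  - exact: ltW.
  - by rewrite invr_ge0 ltW// om0.
  - by apply: le_trans t2 _; rewrite ger_pMr ?exprn_gt0.
  - rewrite lef_pV2 ?posrE ?om0 ?mulr_gt0//; rewrite mulrC.
    apply: le_trans oj _; apply: majorant_homo => //.
    by rewrite t1 andbT ltW.
apply: (@le_trans _ _ (L * (h ^+ j / q ^+ j.+1) * h ^+ j)).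
  apply: ler_wpM2l; first by rewrite mulr_ge0// divr_ge0 ?exprn_ge0 ?ltW.
  rewrite ler0_norm ?subr_le0// opprB.
  apply: (@le_trans _ _ (sj j)); first by rewrite gerBl ltW.
  by rewrite ger_pMr ?exprn_gt0.
rewrite le_eqVlt; apply/orP; left; apply/eqP.
have -> : z = h * h / q by rewrite /z mulrAC.
rewrite expr_div_n exprMn (exprS q j).
have qjp := exprn_gt0 j q0; have qp := q0.
move: qjp qp; move: (q ^+ j) (h ^+ j) q L => qj hj q' L' qjp qp; field.
by rewrite !gt_eqF.
Qed.

Let Q0_le : `|Q s0| <= V * C / w0.
Proof.
have ss : 0 < s0 <= s0 by rewrite s00 lexx.
have sn : 0 < s0 ^+ (n + 6) by rewrite exprn_gt0.
rewrite normrM (gtr0_norm (_ : 0 < (s0 ^+ (n + 6))^-1)) ?invr_gt0//.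
apply: (@le_trans _ _ ((s0 ^+ (n + 6))^-1 *
    (s0 * s0 ^+ (2 * 2) * (s0 ^+ n * V * (C * s0 / w0))))).
  by apply: ler_wpM2l; [rewrite invr_ge0 ltW|exact: P_le].
rewrite le_eqVlt; apply/orP; left; apply/eqP.
have -> : s0 ^+ (n + 6) = s0 ^+ n * (s0 * (s0 * s0 ^+ (2 * 2))) by rewrite exprD -!exprS.
have snp := exprn_gt0 n s00; have wp := w00; have sp := s00.
move: snp wp sp; move: (s0 ^+ n) w0 s0 => sn' w s snp wp sp; field.
by rewrite !gt_eqF.
Qed.

Let Q_le N : `|Q (sj N)| <= V * C / w0 + L / q / (1 - z).
Proof.
suff H : `|Q (sj N)| <= V * C / w0 + L / q * \sum_(0 <= j < N) z ^+ j.
  apply: le_trans H _; rewrite lerD2l; apply: ler_wpM2l; last exact: geometric_sum_le.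
  by rewrite divr_ge0// ltW.
elim: N => [|N IH]; first by rewrite big_nil mulr0 addr0 /sj expr0 mul1r.
rewrite big_nat_recr//= mulrDr addrA.
rewrite -[Q _](subrK (Q (sj N))) addrC; apply: le_trans (ler_normD _ _) _.
exact: lerD.
Qed.

(** Chosen so that [rint_wbump3_ge] reads [rint (wbump x s 3) >= c s^(n+6)]. *)
Let c : R := 27 / 64 * (h ^+ n * V).

Let c0 : 0 < c.
Proof. by rewrite mulr_gt0// mulr_gt0// exprn_gt0. Qed.

(** First-order expansion of [u] at [x]: the constant term integrates to 0 by [rint_zbump], and of
    the linear terms only the [e]-th survives, by [rint_zzbump]. *)
Let P2_expand s : 0 < s <= s0 ->
  P 2 s = rint (fun y => (u y - u x - \sum_(i < n) partial i u x * zc x i y) *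
                         (zc x e y * wbump x s 2 y)) +
          partial e u x * (rint (wbump x s 3) / 6).
Proof.
move=> ss; have /andP[sp _] := ss; have sp' := ltW sp.
have sA := inball0 s ss.
set rem := fun y => _ * (zc x e y * _).
have Irem : row_integrable rem.
  apply: (row_integrable_zbump (eball 0 1)) => // y Ay.
  apply: continuousB; first by apply: continuousB; [exact: cu|exact: cst_continuous].
  by apply: continuous_sum => i; apply: continuousZf; exact: continuous_zc.
have Iz : row_integrable (fun y => zc x e y * wbump x s 2 y).
  by apply: (row_integrable_supported x s); [exact: continuous_zbump|exact: supported_zbump].
have Izz i : row_integrable (fun y => zc x i y * (zc x e y * wbump x s 2 y)).
  by apply: (row_integrable_zbump setT) => // y _; exact: continuous_zc.
have Igzz i : row_integrable (fun y => partial i u x * (zc x i y * (zc x e y * wbump x s 2 y))).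
  exact: (integrableZl measurableT _ (Izz i)).
have Iuz : row_integrable (fun y => u x * (zc x e y * wbump x s 2 y)).
  exact: (integrableZl measurableT _ Iz).
have [Isum Esum] := rint_sum _ _ Igzz.
have -> : P 2 s = rint (fun y => rem y + (u x * (zc x e y * wbump x s 2 y) +
    \sum_(i < n) partial i u x * (zc x i y * (zc x e y * wbump x s 2 y)))).
  rewrite /P; congr rint; apply/funext => y; rewrite /rem.
  have -> : \sum_(i < n) partial i u x * (zc x i y * (zc x e y * wbump x s 2 y)) =
    (\sum_(i < n) partial i u x * zc x i y) * (zc x e y * wbump x s 2 y).
    by rewrite mulr_suml; apply: eq_bigr => i _; rewrite mulrA.
  by ring.
rewrite rintD//; last exact: (integrableD measurableT Iuz Isum).
congr (_ + _); rewrite rintD// rintZ// rint_zbump// mulr0 add0r Esum.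
rewrite (bigD1 e)//= big1 ?addr0 => [|i /negbTE ie]; rewrite rintZ// rint_zzbump//.
  by rewrite eqxx mul1r.
by rewrite ie mul0r mulr0.
Qed.

(** One scale [s = sj N], small in terms of [eps], replaces the limit of [Q]: there the Taylor
    remainder is at most [eps s], so its kernel integral is at most [eps V s^(n+6)], and [Q_le] does
    not depend on [N]. Dividing by [s^(n+6)] gives the claim. *)
Let partial_le_eps eps : 0 < eps ->
  `|partial e u x| * (c / 6) <= V * C / w0 + L / q / (1 - z) + eps * V.
Proof.
move=> e0.
have /nbhs_ballP[d /= dp dP] := C1_linear_approx (eball 0 1) u x eps (open_eball 0 1) C1u x1 e0.
have [N HN] : exists N, sj N < d.
  have : (h ^+ N) @[N --> \oo] --> (0 : R).
    by apply: cvg_expr; rewrite ger0_norm ?(ltW h0).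
  have ds0 : 0 < d / s0 by rewrite divr_gt0.
  move=> /cvgrPdist_lt/(_ _ ds0)[N _ /(_ N (leqnn N))/=].
  rewrite sub0r normrN ger0_norm ?exprn_ge0 ?(ltW h0)// => HJ.
  by exists N; rewrite /sj -ltr_pdivlMr.
set s := sj N.
have sp : 0 < s := sj_gt0 N; have sp' := ltW sp.
have ss : 0 < s <= s0 by rewrite sp sj_le.
have sA := inball0 s ss.
pose rem y := u y - u x - \sum_(i < n) partial i u x * zc x i y.
have crem y : eball 0 1 y -> {for y, continuous rem}.
  move=> Ay; apply: continuousB.
    by apply: continuousB; [exact: cu|exact: cst_continuous].
  by apply: continuous_sum => i; apply: continuousZf; exact: continuous_zc.
have remb : (ball_int x s rem <= (s ^+ n * V * (eps * s))%:E)%E.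
  apply: (@le_trans _ _ (\int[lebesgue_pow n]_(t in row_of_tuple @^-1` eball x s)
      (eps * s)%:E)%E).
    apply: ge0_le_integral => //; first exact: measurable_eball.
      exact: (measurable_ball_abs (eball 0 1)).
    move=> t Bt; rewrite lee_fin.
    have ts : enorm (row_of_tuple t - x) < s by exact: Bt.
    have := dP (row_of_tuple t - x).
    rewrite (_ : x + (row_of_tuple t - x) = row_of_tuple t); last by rewrite addrC subrK.
    move=> H.
    have -> : rem (row_of_tuple t) = u (row_of_tuple t) - u x -
        \sum_(i < n) partial i u x * (row_of_tuple t - x) 0 i.
      by rewrite /rem; congr (_ - _); apply: eq_bigr => i _; rewrite /zc !mxE.
    apply: le_trans (H _) _; last by rewrite ler_wpM2l ?ltW.
    rewrite -ball_normE/= sub0r normrN; apply: norm_rv_lt => // i.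
    by apply: le_lt_trans (coord_le_enorm _ _) _; exact: lt_trans HN.
  rewrite integral_cst; last exact: measurable_eball.
  apply: (@le_trans _ _ ((eps * s)%:E * volume (eball x s))%E); first by [].
  by rewrite volumeE// -EFinM mulrC.
have H := rint_zbump_le (eball 0 1) x s e 1 rem _ sp' sA crem remb.
have E := P2_expand s ss; rewrite -/rem in E.
have b3 := rint_wbump3_ge x s sp.
have b30 : 0 <= rint (wbump x s 3).
  by apply: le_trans b3; rewrite !mulr_ge0 ?exprn_ge0 ?divr_ge0// ltW.
have sn : 0 < s ^+ (n + 6) by rewrite exprn_gt0.
have PQ : `|P 2 s| <= (V * C / w0 + L / q / (1 - z)) * s ^+ (n + 6).
  apply: le_trans (ler_wpM2r (ltW sn) (Q_le N)); rewrite -/s /Q.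
  by rewrite normrM gtr0_norm ?invr_gt0// mulrAC mulVf ?mul1r ?gt_eqF.
rewrite -(ler_pM2r sn).
apply: (@le_trans _ _ (`|partial e u x * (rint (wbump x s 3) / 6)|)).
  rewrite normrM (ger0_norm (_ : 0 <= rint (wbump x s 3) / 6)) ?divr_ge0//.
  rewrite -mulrA; apply: ler_wpM2l => //.
  rewrite mulrAC ler_pM2r ?invr_gt0//; apply: le_trans b3.
  rewrite le_eqVlt; apply/orP; left; apply/eqP.
  rewrite /c exprD (_ : (s / 2) ^+ n = s ^+ n * h ^+ n); last by rewrite exprMn.
  by rewrite -/V; move: (s ^+ n) (s ^+ 6) (h ^+ n) V => a b d' v; ring.
have -> : partial e u x * (rint (wbump x s 3) / 6) =
    P 2 s - rint (fun y => rem y * (zc x e y * wbump x s 2 y)) by rewrite E addrC addKr.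
apply: le_trans (ler_normB _ _) _; rewrite [leRHS]mulrDl; apply: lerD => //.
apply: le_trans H _.
rewrite exprD le_eqVlt; apply/orP; left; apply/eqP.
have -> : s ^+ 6 = s * s ^+ (2 * 2) * s by rewrite -exprS -exprSr.
by move: (s ^+ n) (s ^+ (2 * 2)) (s) V => a b s' v; ring.
Qed.

(** Obtained by letting [eps] tend to 0. The right side depends on neither [x] nor [e], as the
    supremum requires. *)
Lemma partial_le : `|partial e u x| * (c / 6) * w0 <=
  V * C * (1 + lambda / 6 / q / (1 - z)).
Proof.
have z1 : 0 < 1 - z by rewrite subr_gt0; case/andP: z01.
rewrite -ler_pdivlMr//.
have -> : V * C * (1 + lambda / 6 / q / (1 - z)) / w0 = V * C / w0 + L / q / (1 - z).
  by rewrite /L; move: w0 w00 q q0 (z) z1 => w wp q' qp z' zp; field; rewrite !gt_eqF.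
apply/ler_addgt0Pr => eps e0.
have := partial_le_eps (eps / V) (divr_gt0 e0 V0).
by rewrite divfK ?gt_eqF.
Qed.

End one_point.
End oscillation_to_bloch.

Lemma bloch_norm_ltyP (R : realType) (n : nat) (alpha : R) (omega : R -> R)
    (u : 'rV[R]_n -> R) :
  (bloch_norm omega alpha u < +oo)%E <-> exists M, forall x, eball 0 1 x ->
    enorm (grad u x) * omega (dist_bd x `^ alpha) <= M.
Proof.
rewrite /bloch_norm; set S := [set _ | _ in _]; split.
(* A supremum equal to [-oo] would leave no [x] in the ball. *)
- have [S0 _|] := eqVneq (ereal_sup S) -oo%E.
    exists 0 => x x1.
    have /(ereal_sup_ubound (S := S)) :
      S (enorm (grad u x) * omega (dist_bd x `^ alpha))%:E by exists x.
    by rewrite S0 leeNy_eq.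
  case E : (ereal_sup S) => [M| |]//= _.
  move=> _; exists M => x x1; rewrite -lee_fin -E.
  by apply: ereal_sup_ubound; exists x.
- move=> [M HM]; apply: (@le_lt_trans _ _ (`|u 0|%:E + M%:E)%E); last by rewrite -EFinD ltry.
  rewrite leeD2l//; apply: ge_ereal_sup => _ [x x1 <-].
  by rewrite lee_fin; exact: HM.
Qed.

Theorem theorem1 (R : realType) (n : nat) (alpha lambda : R) (omega : R -> R)
    (u : 'rV[R]_n -> R) :
  (2 <= n)%N -> 1 <= alpha < 2 -> majorant omega -> 0 <= lambda ->
  C2_on (eball 0 1) u ->
  (forall x, eball 0 1 x -> laplacian u x = lambda * u x) ->
  (bloch_norm omega alpha u < +oo)%E <->
  exists C : R, 0 < C /\
    forall (x : 'rV[R]_n) (r : R), eball 0 1 x -> 0 < r <= dist_bd x ->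
      (ball_mean x r (fun y => `|u y - u x|%R) <=
       (C * r / omega (r `^ alpha))%R%:E)%E.
Proof.
move=> n2 alpha12 maj lambda0 C2u helm.
have n0 : (0 < n)%N by exact: leq_trans n2.
have alpha0 : 0 <= alpha by apply: le_trans ler01 _; case/andP: alpha12.
have om0 r : 0 < r -> 0 < omega (r `^ alpha).
  by move=> r0; case: maj => _ _ _ + _; apply; rewrite powR_gt0.
split=> [/bloch_norm_ltyP[M HM]|[C [C0 osc]]].
(* [oscillation_le] wants a nonnegative bound, and nothing is known of the sign of [M]. *)
- pose M' := Num.max M 0.
  have M0 : 0 <= M' by rewrite le_max lexx orbT.
  have HM' x : eball 0 1 x -> enorm (grad u x) * omega (dist_bd x `^ alpha) <= M'.
    by move=> x1; rewrite le_max HM.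
  set K := n%:R * (2^-1 / 2^-1 `^ alpha) / (1 - 2^-1 / 2^-1 `^ alpha * 2^-1) * M'.
  exists (`|K| + 1); split=> [|x r x1 rd]; first by rewrite ltr_wpDl.
  have /andP[r0 _] := rd.
  have := oscillation_le omega alpha M' u n0 alpha12 maj M0 C2u.1 HM' x r rd.
  move/le_trans; apply; rewrite lee_fin ler_pM2r ?invr_gt0 ?om0// ler_pM2r//.
  by apply: (@le_trans _ _ `|K|); [exact: ler_norm|rewrite lerDl].
- apply/bloch_norm_ltyP.
  pose q : R := 2^-1 `^ alpha.
  have q0 : 0 < q by rewrite powR_gt0.
  pose c : R := 27 / 64 * (2^-1 ^+ n * @uvol R n).
  have c0 : 0 < c by rewrite !mulr_gt0 ?exprn_gt0 ?uvol_gt0.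
  pose D : R := @uvol R n * C * (1 + lambda / 6 / q / (1 - 2^-1 / q * 2^-1)).
  (* [D / (c / 6)] bounds each partial derivative times [w0], [n] accounts for the sum over
     coordinates, and [1 / q] passes from the weight at half the distance to the weight at
     [dist_bd x]. *)
  exists (n%:R * (D / (c / 6)) / q) => x x1.
  have d0 : 0 < dist_bd x by move: x1; rewrite /eball/= subr0 /dist_bd subr_gt0.
  set w := omega (dist_bd x `^ alpha); set w0 := omega ((dist_bd x / 2) `^ alpha).
  have w00 : 0 < w0 by apply: om0; rewrite divr_gt0.
  have ww : q * w <= w0.
    rewrite /w0 (mulrC (dist_bd x)); apply: majorant_powR_scale => //.
    by apply/andP; split; lra.
  have g_le : enorm (grad u x) * w0 <= n%:R * (D / (c / 6)).
    apply: (@le_trans _ _ (\sum_(i < n) `|partial i u x| * w0)).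
      rewrite -mulr_suml ler_pM2r//; apply: le_trans (enorm_le_sum _) _.
      by apply: ler_sum => i _; rewrite mxE.
    rewrite [leRHS]mulr_natl -[X in _ *+ X]card_ord -sumr_const.
    apply: ler_sum => i _.
    rewrite ler_pdivlMr ?divr_gt0// mulrAC.
    exact: (partial_le omega alpha lambda C u alpha12 maj lambda0 C0 C2u helm osc x i x1).
  rewrite ler_pdivlMr//; apply: le_trans g_le.
  by rewrite -mulrA (mulrC w) ler_wpM2l ?enorm_ge0.
Qed.
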